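(* Let $U,V,W\subset\mathbb{C}$ be non-empty and compact, and put $u^*:=\max_{u\in U}|u|$, $u_*:=\min_{u\in U}|u|$, $w^*:=\max_{w\in W}|w|$, $w_*:=\min_{w\in W}|w|$. (a) For every $A\in\Psi E(U,V,W)$ and every $A_+\in\Psi E_+(U,V,W)$ one has $$V+E(U,W)\ \subseteq\ \bigcup_{B\in M(U,V,W)}\mathrm{spec}\,B\ =\ \bigcup_{B\in M(U,V,W)}\mathrm{spec}^\infty_{\mathrm{pt}}\,B\ =\ \bigcup_{B\in M(U,V,W)}\mathrm{spec}_{\mathrm{ess}}\,B\ =\ \bigcup_{B_+\in M_+(U,V,W)}\mathrm{spec}_{\mathrm{ess}}\,B_+$$ $$=\ \mathrm{spec}_{\mathrm{ess}}\,A\ =\ \mathrm{spec}\,A\ =\ \mathrm{spec}_{\mathrm{ess}}\,A_+\ \subseteq\ \mathrm{spec}\,A_+\ \subseteq\ V+(u^*+w^* )\overline{\mathbb{D}}.$$ (b) The upper bound $\mathrm{spec}\,A\subseteq V+(u^*+w^* )\overline{\mathbb{D}}$ holds for arbitrary $A\in M(U,V,W)$, as well as for arbitrary $A\in M_+(U,V,W)$ and arbitrary $A\in M_{\mathrm{fin}}(U,V,W)$. Moreover, for every $A\in M(U,V,W)$: if $u_*>w^*$ (i.e. $|u|>|w|$ for all $u\in U$, $w\in W$), then $\mathrm{spec}\,A\subset\mathbb{C}\setminus\bigcap_{v\in V}\big(v+(u_*-w^* )\mathbb{D}\big)$; if $u^*<w_*$ (i.e. $|u|<|w|$ for all $u\in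 U$, $w\in W$), then $\mathrm{spec}\,A\subset\mathbb{C}\setminus\bigcap_{v\in V}\big(v+(w_*-u^* )\mathbb{D}\big)$.
   Context: $\mathbb{N}=\{1,2,3,\dots\}$; $\mathbb{D}=\{z\in\mathbb{C}:|z|<1\}$ and $\overline{\mathbb{D}}$ is its closure. For sets $S,T\subseteq\mathbb{C}$ and $s\in\mathbb{C}$: $S+T=\{s'+t:s'\in S,t\in T\}$, $s+T=\{s\}+T$, $sT=\{st:t\in T\}$. Matrices. $M(U,V,W)$ is the set of all bi-infinite tridiagonal matrices $A=(a_{ij})_{i,j\in\mathbb{Z}}$ with $a_{i,i-1}=u_i\in U$, $a_{ii}=v_i\in V$, $a_{i,i+1}=w_i\in W$ for all $i\in\mathbb{Z}$ and all other entries zero. $M_+(U,V,W)$ is the set of all semi-infinite tridiagonal matrices indexed by $\mathbb{N}\times\mathbb{N}$ with subdiagonal entries in $U$, main diagonal entries in $V$, superdiagonal entries in $W$ (all other entries zero). $M_n(U,V,W)$ is the set of $n\times n$ matrices of the same type, and $M_{\mathrm{fin}}(U,V,W)=\bigcup_{n\in\mathbb{N}}M_n(U,V,W)$. Matrices are identified with the bounded linear operators they induce by matrix-vector multiplication on $\ell^p(\mathbb{Z})$, $\ell^p(\mathbb{N})$, $\mathbb{C}^n$, respectively, where $p\in[1,\infty]$. Spectra. $\mathrm{spec}\,B$ is the set of $\lambda\in\mathbb{C}$ such that $B-\lambda I$ is not invertible; $\mathrm{spec}_{\mathrm{ess}}\,B$ is the set of $\lambda$ such that $B-\lambda I$ is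 not a Fredholm operator (Fredholm: finite-dimensional kernel and image of finite codimension). For the band matrices considered here both sets are known not to depend on $p\in[1,\infty]$, so $p$ is suppressed. $\mathrm{spec}^\infty_{\mathrm{pt}}\,B$ is the set of $\lambda\in\mathbb{C}$ such that $B-\lambda I$ is not injective on $\ell^\infty(\mathbb{Z})$. Pseudoergodicity. For a metric space $(\mathcal{M},d)$ and an index set $\mathbb{I}\in\{\mathbb{Z},\mathbb{N},\mathbb{Z}\setminus\mathbb{N}\}$, a sequence $(a_i)_{i\in\mathbb{I}}$ in $\mathcal{M}$ is pseudoergodic if for every $\varepsilon>0$, every $n\in\mathbb{N}$ and every $(b_1,\dots,b_n)\in\mathcal{M}^n$ there is $k\in\mathbb{I}$ with $k+1,\dots,k+n\in\mathbb{I}$ and $d(a_{k+i},b_i)<\varepsilon$ for $i=1,\dots,n$. For $A\in M(U,V,W)$ let $a_i:=(u_i,v_i,w_i)\in\mathcal{M}:=U\times V\times W\subset\mathbb{C}^3$. Then $A\in\Psi E(U,V,W)$ means that $(a_i)_{i\in\mathbb{Z}}$ is pseudoergodic. $\Psi E_+(U,V,W)$ is the set of all semi-infinite submatrices $A_+=(a_{ij})_{i,j\in\mathbb{N}}$ of those $A\in M(U,V,W)$ for which $(a_i)_{i\in\mathbb{N}}$ is pseudoergodic. In part (a), $A$ and $A_+$ need not be related to each other. Ellipses. For $u,w\in\mathbb{C}$, $E(u,w):=\{v\in\mathbb{C}:|v+2\sqrt{uw}|+|v-2\sqrt{uw}|=2(|u|+|w|)\}$ (a possibly degenerate ellipse),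 and $E(U,W):=\bigcup_{u\in U,\,w\in W}E(u,w)$. *)

(* Defs.v *)
From HB Require Import structures.
From mathcomp Require Import all_boot all_order all_algebra complex.
From mathcomp Require Import all_classical all_reals all_analysis.

Set Implicit Arguments.
Unset Strict Implicit.
Unset Printing Implicit Defensive.

Import Order.TTheory GRing.Theory Num.Theory.
Import numFieldNormedType.Exports.

Local Open Scope classical_set_scope.
Local Open Scope ring_scope.

(* The complex numbers R[i], typed as a numClosedFieldType so that the norm
   topology of numFieldNormedType is found by unification. *)
Definition Cplx (R : realType) : numClosedFieldType := R[i]%C.

(* The real-valued modulus; the generic norm `|z| takes its values in
   Cplx R. *)
Definition modulus (R : realType) (z : Cplx R) : R := complex.Re `|z|.

Definition toC (R : realType) (r : R) : Cplx R := r%:C%C.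

(* int carries the discrete sigma-algebra, as nat does in the library, so that
   the l^p norms below are Lnorm for the counting measure. *)
HB.instance Definition _ := isPointed.Build int 0.
HB.instance Definition _ := @isMeasurable.Build default_measure_display
  int discrete_measurable discrete_measurable0
  discrete_measurableC discrete_measurableU.

Section PlaneSets.
Variable R : realType.
Local Notation C := (Cplx R).
Implicit Types (S T U W : set C) (s u w : C).

Definition sumset S T : set C := [set s + t | s in S & t in T].
Definition translate s T : set C := sumset [set s] T.
Definition dilate s T : set C := [set s * t | t in T].

Definition unit_disc : set C := [set z | `|z| < 1].

(* sup and inf are attained on non-empty compact sets. *)
Definition max_modulus U : R := sup [set modulus u | u in U].
Definition min_modulus U : R := inf [set modulus u | u in U].

Definition ellipse u w : set C :=
  [set v | `|v + 2 * sqrtC (u * w)| + `|v - 2 * sqrtC (u * w)|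
           = 2 * (`|u| + `|w|)].

Definition ellipses U W : set C :=
  \bigcup_(u in U) \bigcup_(w in W) ellipse u w.

End PlaneSets.

Section Operators.
Variables (R : realType) (d : measure_display) (I : measurableType d).
Local Notation C := (Cplx R).
Implicit Types (p : \bar R) (x : I -> C) (B : I -> I -> C).
Implicit Types (T : (I -> C) -> (I -> C)).

(* Used for I = int and I = nat only, where every function is measurable and
   only the empty set is negligible. *)
Definition lp_norm p x : \bar R :=
  Lnorm (@counting I R) p (fun i => (modulus (x i))%:E).

Definition lp p : set (I -> C) := [set x | (lp_norm p x < +oo)%E].

(* The sum is over the (finite) support of its summand: B is meant to have
   finitely supported rows. *)
Definition mulmv B x : I -> C := fun i => \sum_(j \in [set: I]) B i j * x j.

Definition shifted_op B (lam : C) x : I -> C := mulmv B x - lam *: x.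

(* Invertibility among the bounded operators on l^p; a two-sided inverse of a
   linear map is automatically linear. *)
Definition invertible_on p T : Prop :=
  exists S : (I -> C) -> (I -> C),
    [/\ forall x, lp p x -> lp p (S x),
        exists K : R, forall x, lp p x ->
          (lp_norm p (S x) <= K%:E * lp_norm p x)%E,
        forall x, lp p x -> S (T x) = x
      & forall x, lp p x -> T (S x) = x].

Definition finite_dim (X : set (I -> C)) : Prop :=
  exists (n : nat) (v : 'I_n -> I -> C), (forall k, X (v k)) /\
    forall x, X x -> exists c : 'I_n -> C, x = \sum_(k < n) c k *: v k.

Definition finite_codim (X Y : set (I -> C)) : Prop :=
  exists (n : nat) (v : 'I_n -> I -> C), (forall k, X (v k)) /\
    forall x, X x -> exists2 y, Y y &
      exists c : 'I_n -> C, x = y + \sum_(k < n) c k *: v k.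

Definition fredholm_on p T : Prop :=
  finite_dim (lp p `&` [set x | T x = 0]) /\
  finite_codim (lp p) (T @` lp p).

Definition spec p B : set C :=
  [set lam | ~ invertible_on p (shifted_op B lam)].

Definition spec_ess p B : set C :=
  [set lam | ~ fredholm_on p (shifted_op B lam)].

Definition spec_pt_infty B : set C :=
  [set lam | ~ set_inj (lp +oo%E) (shifted_op B lam)].

End Operators.

Definition spec_mx (R : realType) (n : nat) (A : 'M[Cplx R]_n) : set (Cplx R) :=
  [set lam | ~ (A - lam%:M \in unitmx)].

Section Tridiagonal.
Variable R : realType.
Local Notation C := (Cplx R).
Variables U V W : set C.

(* [pos] gives the position of an index in the integers. *)
Definition tridiagonal (I : Type) (pos : I -> int) (A : I -> I -> C) : Prop :=
  forall i j, [/\ pos j = pos i - 1 -> U (A i j),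
                  pos j = pos i -> V (A i j),
                  pos j = pos i + 1 -> W (A i j)
                & 1 < `|pos i - pos j| -> A i j = 0].

Definition M_bi : set (int -> int -> C) := [set A | tridiagonal id A].

(* Semi-infinite matrices are indexed by nat from 0: the index n stands for the
   (n+1)-st row or column. *)
Definition M_plus : set (nat -> nat -> C) := [set A | tridiagonal Posz A].

Definition M_n (n : nat) : set 'M[C]_n :=
  [set A | tridiagonal (fun i : 'I_n => (i : nat)%:Z) (fun i j => A i j)].

(* [dist] is the metric of the space M, a subset of T. *)
Definition pseudoergodic (T : Type) (dist : T -> T -> R) (M : set T)
    (I : set int) (a : int -> T) : Prop :=
  forall (eps : R) (n : nat) (b : nat -> T), 0 < eps -> (0 < n)%N ->
    (forall i, (0 < i <= n)%N -> M (b i)) ->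
    exists k : int, I k /\ forall i, (0 < i <= n)%N ->
      I (k + i%:Z) /\ dist (a (k + i%:Z)) (b i) < eps.

Definition dist3 (x y : C * C * C) : R :=
  Num.sqrt (modulus (x.1.1 - y.1.1) ^+ 2 + modulus (x.1.2 - y.1.2) ^+ 2
            + modulus (x.2 - y.2) ^+ 2).

Definition diagonals (A : int -> int -> C) (i : int) : C * C * C :=
  (A i (i - 1), A i i, A i (i + 1)).

Definition PsiE_on (I : set int) : set (int -> int -> C) :=
  M_bi `&` [set A | pseudoergodic dist3 (U `*` V `*` W) I (diagonals A)].

Definition PsiE : set (int -> int -> C) := PsiE_on setT.

Definition PsiE_plus : set (nat -> nat -> C) :=
  [set (fun i j : nat => A i.+1%:Z j.+1%:Z) | A in PsiE_on [set i | 0 < i]].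

End Tridiagonal.

(* Main.v *)
Require Import Defs.
(** Fix [lam] and let (H) be the statement that, for every [B] in [M(U,V,W)],
    [B - lam] is injective on bounded sequences. The sets claimed equal are all the
    set of those [lam] for which (H) fails.
    If (H) holds, then by compactness of [U], [V], [W] there are [N] and [c > 0],
    common to all [B], such that [|x_k| <= 2 |x_i|] for [|k - i| <= N] forces
    [|((B - lam) x)_k| >= c |x_i|] for some such [k]. Iterating, [x_i] is dominated
    by one entry of [(B - lam) x], with a weight decaying exponentially in the
    distance; this bounds [x] by [(B - lam) x] in every [l^p]. Replacing [B] by
    periodic matrices, on which injectivity is surjectivity, and passing to the
    limit gives invertibility, and semi-infinite matrices are compressions of
    bi-infinite ones.
    If (H) fails, a bounded kernel vector weighted by [r^|k|], [r] close to 1, and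
    truncated is an approximate kernel vector in every [l^p]; a pseudoergodic
    matrix contains copies of it away from any finite set. A Baire argument on
    the sums [sum_j b_j 2^j T y_j], [b] in the Cantor space, shows that an operator
    [T] with such a sequence [y_j] is not Fredholm.
    The enclosures in (b) are conditions under which (H) holds. *)
From HB Require Import structures.
From mathcomp Require Import all_boot all_order all_algebra complex finmap.
From mathcomp Require Import all_classical all_reals all_analysis.
From mathcomp Require Import measurable_realfun ess_sup_inf.
From mathcomp Require Import ring lra zify.
Set Implicit Arguments.
Unset Strict Implicit.
Unset Printing Implicit Defensive.
Import Order.TTheory GRing.Theory Num.Theory.
Import numFieldNormedType.Exports.
Local Open Scope classical_set_scope.
Local Open Scope ring_scope.

(** * The modulus and the l^p norms *)

Section Modulus.
Variable R : realType.
Local Notation C := (Cplx R).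
Implicit Types (z : C) (a b : R).

(** (H) does not mention p, and every l^p statement is derived from it, so the sets come out the
    same for all p. The class of matrices is invariant under translation, so failing windows can be
    recentred at 0, and one ultrafilter gives limits at all places at once. Bounds must not depend
    on the matrix: only then do the periodic problems, which are finite square systems, pass to the
    limit. [fredholm_on] is purely algebraic and says nothing of a closed range or a bounded
    inverse. Hence the weights 2^j: the sums of b_j 2^j y_j may leave l^p while their images, with
    terms of size at most 2^j 4^-j, stay in it; finite codimension would supply, up to a
    finite-dimensional correction, preimages of bounded size, too short for 2^j y_j. Cutting off a
    bounded kernel vector sharply may leave an error comparable to its norm; geometric weights
    prevent this for every p. On the half-line the entries at the cut matter: taken from U and W
    they give the Fredholm property, taken as 0 they give invertibility, but then (H) is needed with
    0 adjoined to U and W, which the disc enclosure tolerates. *)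

Lemma toC_modulus z : toC (modulus z) = `|z|.
Proof. by rewrite /toC /modulus; apply: RRe_real; apply: normr_real. Qed.

Lemma ler_toC a b : (toC a <= toC b) = (a <= b).
Proof. exact: lecR. Qed.

Lemma ltr_toC a b : (toC a < toC b) = (a < b).
Proof. exact: ltcR. Qed.

Lemma toC_inj : injective (@toC R).
Proof. by move=> a b; case. Qed.

Lemma toCD a b : toC (a + b) = toC a + toC b.
Proof. exact: (rmorphD (real_complex R)). Qed.

Lemma toCM a b : toC (a * b) = toC a * toC b.
Proof. exact: (rmorphM (real_complex R)). Qed.

Lemma toC0 : toC (0 : R) = 0.
Proof. by []. Qed.

Lemma toC1 : toC (1 : R) = 1.
Proof. by []. Qed.

Lemma modulus_ge0 z : 0 <= modulus z.
Proof. by rewrite -ler_toC toC_modulus toC0 normr_ge0. Qed.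

Lemma modulus0 : modulus (0 : C) = 0.
Proof. by apply: toC_inj; rewrite toC_modulus normr0. Qed.

Lemma modulus1 : modulus (1 : C) = 1.
Proof. by apply: toC_inj; rewrite toC_modulus normr1. Qed.

Lemma modulus_eq0 z : (modulus z == 0) = (z == 0).
Proof.
apply/eqP/eqP => [h|->]; last exact: modulus0.
by apply/eqP; rewrite -normr_eq0 -toC_modulus h.
Qed.

Lemma modulusD z1 z2 : modulus (z1 + z2) <= modulus z1 + modulus z2.
Proof. by rewrite -ler_toC toCD !toC_modulus ler_normD. Qed.

Lemma modulusM z1 z2 : modulus (z1 * z2) = modulus z1 * modulus z2.
Proof. by apply: toC_inj; rewrite toCM !toC_modulus normrM. Qed.

Lemma modulusN z : modulus (- z) = modulus z.
Proof. by apply: toC_inj; rewrite !toC_modulus normrN. Qed.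

Lemma modulusB z1 z2 : modulus (z1 - z2) <= modulus z1 + modulus z2.
Proof. by rewrite -(modulusN z2) modulusD. Qed.

Lemma modulus_distrC z1 z2 : modulus (z1 - z2) = modulus (z2 - z1).
Proof. by rewrite -modulusN opprB. Qed.

Lemma modulusV z : modulus z^-1 = (modulus z)^-1.
Proof.
have [->|z0] := eqVneq z 0; first by rewrite !(invr0, modulus0).
apply: (mulfI (_ : modulus z != 0)); first by rewrite modulus_eq0.
by rewrite -modulusM !divff ?modulus1 ?modulus_eq0.
Qed.

Lemma modulus_toC a : modulus (toC a) = `|a|.
Proof.
wlog a0 : a / 0 <= a => [H|]; last first.
  by apply: toC_inj; rewrite toC_modulus !ger0_norm// -toC0 ler_toC.
have [/H//|/ltW a0] := leP 0 a.
by rewrite -normrN -H ?oppr_ge0// -modulusN -(rmorphN (real_complex R)).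
Qed.

Lemma modulus_sum (I : Type) (s : seq I) (P : pred I) (f : I -> C) :
  modulus (\sum_(i <- s | P i) f i) <= \sum_(i <- s | P i) modulus (f i).
Proof.
elim/big_rec2: _ => [|i a z _ h]; first by rewrite modulus0.
exact: le_trans (modulusD _ _) (lerD _ h).
Qed.

End Modulus.

(** * Integrals against the counting measure as suprema of finite sums *)

Section CountingIntegral.
Local Open Scope ereal_scope.
Variables (R : realType) (d : measure_display) (I : measurableType d).
Hypothesis mI : forall A : set I, measurable A.
Variable code : I -> nat.
Hypothesis code_inj : injective code.
Variable f : I -> \bar R.
Hypothesis f0 : forall i, 0 <= f i.

Local Notation mu := (@counting I R).

Lemma counting_set1 (i : I) : mu [set i] = 1.
Proof.
rewrite /counting asboolT; last exact: finite_set1.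
rewrite fset_set1 cardfs1.
by [].
Qed.

Lemma integral_counting_set1 i : \int[mu]_(x in [set i]) f x = f i.
Proof.
rewrite (@eq_integral _ _ _ _ _ (cst (f i)))//.
  rewrite integral_cst// [X in _ * X](_ : _ = 1) ?mule1//.
  exact: counting_set1.
by move=> x; rewrite inE /= => ->.
Qed.

Lemma sum_le_integral_counting (s : seq I) : uniq s ->
  \sum_(i <- s) f i <= \int[mu]_x f x.
Proof.
move=> us.
have mf (D : set I) : @measurable_fun _ _ I (\bar R) D f.
  by move=> _ B _; apply: mI.
under eq_bigr do rewrite -integral_counting_set1.
rewrite -ge0_integral_bigsetU//=.
  by apply: ge0_subset_integral.
apply/trivIsetP => i j _ _ /eqP ij; apply/seteqP; split => // x [/= xi xj].
by apply: ij; rewrite -xi -xj.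
Qed.

(** The fibres of [code] are empty or single points, so countable additivity turns the integral into
    a series whose partial sums are sums over duplicate-free lists. *)
Lemma integral_counting_le (M : \bar R) :
  (forall s : seq I, uniq s -> \sum_(i <- s) f i <= M) ->
  \int[mu]_x f x <= M.
Proof.
move=> hM.
have mf (D : set I) : @measurable_fun _ _ I (\bar R) D f.
  by move=> _ B _; apply: mI.
pose F k := [set i | code i = k].
have UF : \bigcup_k F k = [set: I].
  by apply/seteqP; split => // i _; exists (code i).
rewrite -UF ge0_integral_bigcup//; last first.
  apply/trivIsetP => i j _ _ /eqP ij; apply/seteqP; split => // x [/= xi xj].
  by apply: ij; rewrite -xi -xj.
apply: lime_le.
  by apply: is_cvg_nneseries => n _ _; apply: integral_ge0.
near=> n.
suff [s [us hs ->]] : exists s : seq I, [/\ uniq s, forall i, i \in s -> (code i < n)%N &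
   \sum_(0 <= k < n) \int[mu]_(x in F k) f x = \sum_(i <- s) f i].
  exact: hM.
near: n; apply: nearW; elim => [|n [s [us hs IH]]].
  by exists [::]; split => //; rewrite big_geq ?big_nil.
have [[i Fi]|nF] := pselect (exists i, F n i).
- exists (i :: s); split => /=.
  + by rewrite us andbT; apply/negP => /hs; rewrite Fi ltnn.
  + by move=> j; rewrite inE => /orP[/eqP->|/hs/ltnW//]; rewrite Fi.
  + rewrite big_nat_recr//= IH big_cons addeC; congr (_ + _).
    rewrite (_ : F n = [set i]) ?integral_counting_set1//.
    apply/seteqP; split => [j /= Fj|j /= ->//].
    by apply: code_inj; rewrite Fj Fi.
- exists s; split => // [i /hs/ltnW//|].
  rewrite big_nat_recr//= IH (_ : F n = set0) ?integral_set0 ?adde0//.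
  by apply/seteqP; split => // i Fi; case: nF; exists i.
Unshelve. all: by end_near. Qed.

End CountingIntegral.

(** One hypothesis for both index sets, so that estimates can compare vectors on the integers with
    vectors on the naturals. *)
Definition discrete (d : measure_display) (I : measurableType d) : Prop :=
  (forall A : set I, measurable A) /\ exists code : I -> nat, injective code.

Lemma discrete_int : discrete int.
Proof. by split => //; exists choice.pickle; apply: pcan_inj choice.pickleK. Qed.

Lemma discrete_nat : discrete nat.
Proof. by split => //; exists id. Qed.

Section LpNorm.
Variable R : realType.
Local Notation C := (Cplx R).

Section Characterization.
Variables (d : measure_display) (I : measurableType d).
Hypothesis dI : discrete I.
Implicit Types (x : I -> C) (K r : R).

Local Notation mu := (@counting I R).

Lemma lp_norm_finP x r K : 0 < r -> 0 <= K ->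
  (lp_norm r%:E x <= K%:E)%E <->
  forall s : seq I, uniq s -> \sum_(i <- s) modulus (x i) `^ r <= K `^ r.
Proof.
have [mI [code code_inj]] := dI.
move=> r0 K0; rewrite /lp_norm unlock.
have f0 i : (0 <= (`|(modulus (x i))%:E| `^ r))%E by apply: poweR_ge0.
have fE i : (`|(modulus (x i))%:E| `^ r)%E = (modulus (x i) `^ r)%:E.
  by rewrite /= ger0_norm// modulus_ge0.
have -> : ((\int[mu]_i (`|(modulus (x i))%:E| `^ r)) `^ r^-1 <= K%:E)%E <->
   (\int[mu]_i (`|(modulus (x i))%:E| `^ r) <= (K `^ r)%:E)%E.
  have J0 : (0 <= \int[mu]_i (`|(modulus (x i))%:E| `^ r))%E by apply: integral_ge0.
  have e1 : ((K `^ r)%:E `^ r^-1 = K%:E)%E.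
    by rewrite poweR_EFin -powRrM divff ?gt_eqF// powRr1.
  have e2 : ((\int[mu]_i (`|(modulus (x i))%:E| `^ r)) `^ r^-1 `^ r =
             \int[mu]_i (`|(modulus (x i))%:E| `^ r))%E.
    by rewrite -poweRrM mulVf ?gt_eqF// poweRe1.
  split => h.
  - rewrite -e2 -poweR_EFin gt0_ler_poweR//; rewrite ?ltW// in_itv/= ?leey ?poweR_ge0//.
    by rewrite lee_fin K0.
  - rewrite -e1 gt0_ler_poweR//; rewrite ?ltW ?invr_gt0// in_itv/= ?leey ?J0//.
    by rewrite lee_fin powR_ge0.
split => h.
- move=> s us; rewrite -lee_fin; apply: le_trans h; rewrite -sumEFin.
  under eq_bigr do rewrite -fE.
  exact: (sum_le_integral_counting mI f0 us).
- apply: (integral_counting_le mI code_inj f0) => s us.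
  under eq_bigr do rewrite fE.
  by rewrite sumEFin lee_fin h.
Qed.

Lemma lp_norm_ooP x K : 0 <= K ->
  (lp_norm +oo%E x <= K%:E)%E <-> forall i, modulus (x i) <= K.
Proof.
have [mI _] := dI.
move=> K0; rewrite /lp_norm unlock.
have mu1 (A : set I) i : A i -> (0 < mu A)%E.
  move=> Ai; rewrite (@lt_le_trans _ _ 1%E)// -(counting_set1 R i).
  by apply: le_measure; rewrite ?inE => // j ->.
(* The norm for the exponent infinity is an essential supremum only when the whole space has
   positive measure; one point ensures this. *)
rewrite (mu1 _ point)//; split => h.
- move=> i; move: h => /ess_supP [A [mA A0 hA]].
  have [//|hi] := leP (modulus (x i)) K.
  have : (0 < mu A)%E.
    apply: (@mu1 _ i); apply: hA => /=; rewrite ger0_norm ?modulus_ge0//.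
    by rewrite lee_fin leNgt hi.
  by rewrite A0 ltxx.
- apply/ess_supP; apply: aeW => i /=.
  by rewrite ger0_norm ?modulus_ge0// lee_fin.
Qed.

End Characterization.

(* Real bounds instead of values in [\bar R]: the lemmas on [lp_le] are what the
   estimates below need of the l^p norm, uniformly in [p]. *)
Definition lp_le p (d : measure_display) (I : measurableType d) (x : I -> C)
  (K : R) : Prop := (lp_norm p x <= K%:E)%E.

Variable p : \bar R.
Hypothesis p1 : (1 <= p)%E.

Lemma lp_le_ge0 (d : measure_display) (I : measurableType d) (x : I -> C) K :
  lp_le p x K -> 0 <= K.
Proof. by rewrite -lee_fin; apply: le_trans; apply: Lnorm_ge0. Qed.

(* Covers monotonicity, shifts, restriction and extension by zero at once. *)
Lemma lp_le_dominated d (I : measurableType d) d' (J : measurableType d')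
    (h : I -> J) (x : I -> C) (y : J -> C) K :
  discrete I -> discrete J -> {in [pred i | x i != 0] &, injective h} ->
  (forall i, modulus (x i) <= modulus (y (h i))) -> lp_le p y K -> lp_le p x K.
Proof.
move=> dI dJ hinj hxy yK; have K0 := lp_le_ge0 yK.
move: p1 yK; rewrite /lp_le; case: p => [r||] //; rewrite ?lee_fin => r1 yK.
- have r0 : 0 < r by rewrite (lt_le_trans _ r1).
  apply/(lp_norm_finP dI x r0 K0) => s us.
  rewrite (bigID (fun i => x i != 0))/= [X in _ + X]big1 ?addr0 => [|i]; last first.
    by rewrite negbK => /eqP ->; rewrite modulus0 powR0// gt_eqF.
  pose s' := map h (seq.filter (fun i => x i != 0) s).
  apply: (@le_trans _ _ (\sum_(j <- s') modulus (y j) `^ r)).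
    rewrite /s' big_map big_filter; apply: ler_sum => i _.
    by rewrite ge0_ler_powR ?nnegrE ?modulus_ge0 ?(ltW r0).
  apply: (lp_norm_finP dJ y r0 K0).1 => //.
  rewrite map_inj_in_uniq ?filter_uniq// => i j.
  by rewrite !mem_filter => /andP[xi _] /andP[xj _]; apply: hinj.
- apply/(lp_norm_ooP dI x K0) => i; apply: le_trans (hxy _) _.
  exact: (lp_norm_ooP dJ y K0).1.
Qed.

Section OneIndex.
Variables (d : measure_display) (I : measurableType d).
Hypothesis dI : discrete I.
Implicit Types (x y : I -> C) (K L : R).

Lemma lp_le_mono x y K : (forall i, modulus (x i) <= modulus (y i)) ->
  lp_le p y K -> lp_le p x K.
Proof. exact: lp_le_dominated. Qed.

Lemma lp_leW x K L : K <= L -> lp_le p x K -> lp_le p x L.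
Proof. by move=> KL xK; apply: le_trans xK _; rewrite lee_fin. Qed.

(** Minkowski's inequality is applied to the real functions of moduli, whose sum dominates the
    modulus of the sum. *)
Lemma lp_leD x y K L : lp_le p x K -> lp_le p y L -> lp_le p (x \+ y) (K + L).
Proof.
have [mI _] := dI.
have mf (f : I -> R) : measurable_fun setT f by move=> _ B _; apply: mI.
move=> xK yL; apply: (@lp_le_mono _ (fun i => toC (modulus (x i) + modulus (y i)))).
  by move=> i; rewrite modulus_toC ger0_norm ?modulusD// addr_ge0 ?modulus_ge0.
apply: (@le_trans _ _ (lp_norm p x + lp_norm p y)%E); last first.
  by rewrite EFinD leeD.
apply: (le_trans _ (eminkowski (@counting I R) (mf _) (mf _) p1)).
rewrite /lp_norm le_eqVlt; apply/orP; left; apply/eqP; apply: eq_Lnorm => i.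
by rewrite modulus_toC ger0_norm// addr_ge0 ?modulus_ge0.
Qed.

Lemma lp_le_coord x K i : lp_le p x K -> modulus (x i) <= K.
Proof.
move=> xK; have K0 := lp_le_ge0 xK.
move: p1 xK; rewrite /lp_le; case: p => [r||] //; rewrite ?lee_fin => r1.
- have r0 : 0 < r by rewrite (lt_le_trans _ r1).
  move/(lp_norm_finP dI x r0 K0)/(_ [:: i] isT); rewrite big_seq1.
  apply: contraTT; rewrite -!ltNge => Ki.
  by apply: gt0_ltr_powR; rewrite ?nnegrE ?modulus_ge0.
- by move/(lp_norm_ooP dI x K0).
Qed.

Lemma lp_le_single i K x : modulus (x i) <= K -> (forall j, j != i -> x j = 0) ->
  lp_le p x K.
Proof.
move=> xiK xj; have K0 : 0 <= K by rewrite (le_trans _ xiK) ?modulus_ge0.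
move: p1; rewrite /lp_le; case: p => [r||] //; rewrite ?lee_fin => r1.
- have r0 : 0 < r by rewrite (lt_le_trans _ r1).
  apply/(lp_norm_finP dI x r0 K0) => s us.
  have h : modulus (x i) `^ r <= K `^ r.
    by rewrite ge0_ler_powR ?nnegrE ?modulus_ge0 ?(ltW r0).
  have [si|si] := boolP (i \in s).
    rewrite (bigD1_seq i)//= big1 ?addr0 // => j ji.
    by rewrite xj// modulus0 powR0 ?gt_eqF.
  rewrite big_seq big1 ?powR_ge0// => j js.
  rewrite xj ?modulus0 ?powR0 ?gt_eqF//; apply: contraNneq si => <-//.
- apply/(lp_norm_ooP dI x K0) => j; have [->//|ji] := eqVneq j i.
  by rewrite xj// modulus0.
Qed.

(** Used for vectors not yet known to be in l^p: only finitely many places have to be controlled at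
    a time. *)
Lemma lp_le_fatou x K : 0 <= K ->
  (forall s : seq I, lp_le p (fun i => if i \in s then x i else 0) K) ->
  lp_le p x K.
Proof.
move=> K0; move: p1; rewrite /lp_le; case: p => [r||] //; rewrite ?lee_fin => r1 h.
- have r0 : 0 < r by rewrite (lt_le_trans _ r1).
  apply/(lp_norm_finP dI x r0 K0) => s us.
  have := (lp_norm_finP dI _ r0 K0).1 (h s) s us.
  by rewrite big_seq; under eq_bigr => i -> do []; rewrite -big_seq.
- apply/(lp_norm_ooP dI x K0) => i.
  by have := (lp_norm_ooP dI _ K0).1 (h [:: i]) i; rewrite inE eqxx.
Qed.

Lemma lp_leZ (c : C) x K : lp_le p x K ->
  lp_le p (fun i => c * x i) (modulus c * K).
Proof.
move=> xK; have K0 := lp_le_ge0 xK; have c0 := modulus_ge0 c.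
have cK0 : 0 <= modulus c * K by rewrite mulr_ge0.
move: p1 xK; rewrite /lp_le; case: p => [r||] //; rewrite ?lee_fin => r1.
- have r0 : 0 < r by rewrite (lt_le_trans _ r1).
  move=> /(lp_norm_finP dI x r0 K0) h; apply/(lp_norm_finP dI _ r0 cK0) => s us.
  under eq_bigr do rewrite modulusM powRM ?modulus_ge0//.
  by rewrite -mulr_sumr powRM// ler_wpM2l ?powR_ge0 ?h.
- move=> /(lp_norm_ooP dI x K0) h; apply/(lp_norm_ooP dI _ cK0) => i.
  by rewrite modulusM ler_wpM2l.
Qed.

End OneIndex.
End LpNorm.

(** * Ultralimits *)

Section UltraLimits.
Variable R : realType.
Local Notation C := (Cplx R).

Lemma modulus_le_ReIm (z : C) :
  modulus z <= `|complex.Re z| + `|complex.Im z|.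
Proof.
case: z => a b /=; rewrite /modulus normc_def /=.
rewrite -(ler_pXn2r (n := 2)) ?nnegrE ?sqrtr_ge0 ?addr_ge0//.
rewrite sqr_sqrtr ?addr_ge0 ?sqr_ge0// sqrrD !real_normK ?num_real//.
have : 0 <= `|a| * `|b| by rewrite mulr_ge0.
rewrite mulr2n; lra.
Qed.

Lemma Re_le_modulus (z : C) : `|complex.Re z| <= modulus z.
Proof. 
by rewrite -ler_toC toC_modulus; exact: normc_ge_Re. Qed.

Lemma Im_le_modulus (z : C) : `|complex.Im z| <= modulus z.
Proof.
case: z => a b; rewrite /modulus normc_def /=.
rewrite -(ler_pXn2r (n := 2)) ?nnegrE ?sqrtr_ge0//.
by rewrite sqr_sqrtr ?addr_ge0 ?sqr_ge0// real_normK ?num_real// lerDr sqr_ge0.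
Qed.

Lemma gt0_toC (e : C) : 0 < e -> e = toC (modulus e).
Proof. by move=> e0; rewrite toC_modulus gtr0_norm. Qed.

Variable F : set_system nat.
Context {UF : UltraFilter F}.
Implicit Types (a : nat -> C) (l : C).

(** The norm of [Cplx R] has values in [Cplx R], so the usual epsilon is complex; being positive it
    is real and equals its modulus. *)
Lemma cvg_modulusP a l :
  a @ F --> l <-> forall e : R, 0 < e -> F [set n | modulus (l - a n) < e].
Proof.
split => [al e e0|h].
- have /cvgrPdist_lt/(_ (toC e)) := al.
  rewrite -toC0 ltr_toC => /(_ e0); apply: filterS => n /=.
  by rewrite -toC_modulus ltr_toC.
- apply/cvgrPdist_lt => e e0.
  have := h (modulus e); rewrite -ltr_toC -gt0_toC// => /(_ e0).
  by apply: filterS => n /=; rewrite -toC_modulus [in X in _ -> X](gt0_toC e0) ltr_toC.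
Qed.

Lemma ultra_fmap (T : Type) (f : nat -> T) : UltraFilter (f @ F).
Proof.
split=> [|G PG FG]; first exact: fmap_proper_filter.
apply/seteqP; split => // A GA; have [//|FA] := in_ultra_setVsetC (f @^-1` A) UF.
by have [t []] := filter_ex (filterI GA (FG (~` A) FA)).
Qed.

Lemma ulim_compact (A : set C) a : compact A -> (forall n, A (a n)) ->
  exists2 l, A l & a @ F --> l.
Proof.
rewrite compact_ultra => cA aA.
have [] := cA (a @ F) (ultra_fmap a).
  by apply: (@filterS _ F _ setT) => [n _ /=|]; [exact: aA|exact: filterT].
by move=> l [Al al]; exists l.
Qed.

Lemma ulim_bounded a K : (forall n, modulus (a n) <= K) -> exists l, a @ F --> l.
Proof.
move=> aK.
have lim (f : nat -> R) : (forall n, `|f n| <= K) -> exists r : R, f @ F --> r.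
  move=> fK; have := @segment_compact R (- K) K; rewrite compact_ultra.
  move=> /(_ (f @ F) (ultra_fmap f)) [].
    apply: (@filterS _ F _ setT) => [n _ /=|]; last exact: filterT.
    by rewrite in_itv/= -ler_norml.
  by move=> l [_ fl]; exists l.
have [r rP] := lim (fun n => complex.Re (a n)) (fun n => le_trans (Re_le_modulus _) (aK n)).
have [i iP] := lim (fun n => complex.Im (a n)) (fun n => le_trans (Im_le_modulus _) (aK n)).
exists ((r +i* i)%C : C); apply/cvg_modulusP => e e0.
have e2 : 0 < e / 2 by rewrite divr_gt0.
have := rP; move/cvgrPdist_lt => /(_ _ e2); have := iP; move/cvgrPdist_lt => /(_ _ e2).
apply: filterS2 => n h1 h2; apply: (le_lt_trans (modulus_le_ReIm _)).
rewrite (splitr e); apply: ltrD; first by move: h2; case: (a n).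
by move: h1; case: (a n).
Qed.

Lemma ulim_modulus_le a l K : F [set n | modulus (a n) <= K] -> a @ F --> l ->
  modulus l <= K.
Proof.
move=> aK /cvg_modulusP al; apply/ler_addgt0Pr => e e0.
have [n [/= h1 h2]] := @filter_ex _ _ _ _ (filterI aK (al e e0)).
rewrite -(subrK (a n) l) (le_trans (modulusD _ _))// addrC lerD//.
exact: ltW.
Qed.

End UltraLimits.

(** * Bi-infinite tridiagonal operators injective on bounded sequences *)

Section Jacobi.
Variable R : realType.
Local Notation C := (Cplx R).
Implicit Types (u v w x y : int -> C) (i k l : int).

(** The three diagonals are arguments, so that translation, periodization and pointwise limits act
    on each of them as a sequence. *)
Definition jac u v w x : int -> C :=
  fun k => u k * x (k - 1) + v k * x k + w k * x (k + 1).

Definition bounded_by (I : Type) (x : I -> C) (K : R) := forall i : I, modulus (x i) <= K.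

Lemma jac_shift u v w x i k :
  jac (fun j => u (i + j)) (fun j => v (i + j)) (fun j => w (i + j))
    (fun j => x (i + j)) k = jac u v w x (i + k).
Proof. by rewrite /jac !addrA. Qed.

Lemma jacZ u v w x (c : C) k : jac u v w (fun j => c * x j) k = c * jac u v w x k.
Proof. by rewrite /jac; ring. Qed.

Lemma jacB u v w x y k :
  jac u v w (fun j => x j - y j) k = jac u v w x k - jac u v w y k.
Proof. by rewrite /jac; ring. Qed.

Lemma eq_jac u v w u' v' w' x x' k :
  u k = u' k -> v k = v' k -> w k = w' k ->
  x (k - 1) = x' (k - 1) -> x k = x' k -> x (k + 1) = x' (k + 1) ->
  jac u v w x k = jac u' v' w' x' k.
Proof. by rewrite /jac => -> -> -> -> -> ->. Qed.

Section UltraJac.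
Variable F : set_system nat.
Context {UF : UltraFilter F}.

Lemma cvg_jac (un vn wn xn : nat -> int -> C) u v w x k :
  (forall i, (fun n => un n i) @ F --> u i) ->
  (forall i, (fun n => vn n i) @ F --> v i) ->
  (forall i, (fun n => wn n i) @ F --> w i) ->
  (forall i, (fun n => xn n i) @ F --> x i) ->
  (fun n => jac (un n) (vn n) (wn n) (xn n) k) @ F --> jac u v w x k.
Proof.
move=> hu hv hw hx; apply: cvgD; first apply: cvgD; exact: cvgM.
Qed.

End UltraJac.

Section InjectiveOnBounded.
Variables U V W : set C.
Hypotheses (cU : compact U) (cV : compact V) (cW : compact W).

Definition jac_in u v w := forall k, [/\ U (u k), V (v k) & W (w k)].

(** With [V] replaced by the set of all v - lam, this is the statement (H). *)
Definition jac_injective := forall u v w x K, jac_in u v w -> bounded_by x K ->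
  (forall k, jac u v w x k = 0) -> forall k, x k = 0.

Hypothesis inj : jac_injective.

(* Otherwise normalised and translated counterexamples for [N] tending to infinity
   have an ultralimit, which is a bounded kernel vector. *)
Lemma jac_window : exists N : nat, forall u v w x i, jac_in u v w ->
  (forall k, (absz (k - i) <= N)%N -> modulus (x k) <= 2 * modulus (x i)) ->
  x i != 0 ->
  exists2 k, (absz (k - i) <= N)%N &
    modulus (x i) <= N.+1%:R * modulus (jac u v w x k).
Proof.
apply: contrapT => no.
have {no}H : forall N : nat,
    exists t : (int -> C) * (int -> C) * (int -> C) * (int -> C) * int,
  [/\ jac_in t.1.1.1.1 t.1.1.1.2 t.1.1.2,
   forall k, (absz (k - t.2) <= N)%N -> modulus (t.1.2 k) <= 2 * modulus (t.1.2 t.2),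
   t.1.2 t.2 != 0 &
   forall k, (absz (k - t.2) <= N)%N ->
     N.+1%:R * modulus (jac t.1.1.1.1 t.1.1.1.2 t.1.1.2 t.1.2 k) < modulus (t.1.2 t.2)].
  move=> N; apply: contrapT => noN; apply: no; exists N => u v w x i inM hx xi.
  apply: contrapT => nok; apply: noN; exists (u, v, w, x, i); split => // k ki.
  by rewrite ltNge; apply/negP => h; apply: nok; exists k.
have [t tP] := choice H.
have [F [UF sF]] := ultraFilterLemma eventually_filter.
pose i n := (t n).2; pose x n := (t n).1.2.
(* Outside the window nothing bounds the entries, hence the cut-off; inside, the normalisation makes
   the entry at 0 equal to 1 and bounds the others by 2. *)
pose a n k := if (absz k <= n)%N then (x n (i n))^-1 * x n (i n + k) else 0.
have x0 n : x n (i n) != 0 by have [] := tP n.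
have a2 n : bounded_by (a n) 2.
  move=> k; rewrite /a; case: ifP => kn; last by rewrite modulus0.
  rewrite modulusM modulusV mulrC ler_pdivrMr ?lt_def ?modulus_eq0 ?x0 ?modulus_ge0//.
  by have [_ + _ _] := tP n; apply; rewrite addrAC subrr add0r.
have [b ab] := choice (fun k => ulim_bounded (fun n => a2 n k)).
have hlim (A : set C) (f : nat -> int -> C) : compact A -> (forall n k, A (f n k)) ->
    exists g : int -> C, forall k, A (g k) /\ (fun n => f n k) @ F --> g k.
  move=> cA Af.
  suff /choice[g gP] : forall k, exists z : C, A z /\ (fun n => f n k) @ F --> z.
    by exists g.
  by move=> k; have [l ? ?] := ulim_compact cA (fun n => Af n k); exists l.
have tM n k : [/\ U ((t n).1.1.1.1 (i n + k)), V ((t n).1.1.1.2 (i n + k))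
    & W ((t n).1.1.2 (i n + k))] by have [h _ _ _] := tP n; exact: h.
have [||u uP] := hlim U (fun n k => (t n).1.1.1.1 (i n + k)) => //.
  by move=> n k; have [] := tM n k.
have [||v vP] := hlim V (fun n k => (t n).1.1.1.2 (i n + k)) => //.
  by move=> n k; have [] := tM n k.
have [||w wP] := hlim W (fun n k => (t n).1.1.2 (i n + k)) => //.
  by move=> n k; have [] := tM n k.
have b2 : bounded_by b 2.
  move=> k; apply: (ulim_modulus_le _ (ab k)).
  by apply: (@filterS _ F _ setT) => [n _ /=|]; [exact: a2|exact: filterT].
suff b0 : forall k, b k = 0.
  have : (fun n => a n 0) @ F --> (1 : C).
    rewrite (_ : (fun n => a n 0) = cst 1); first exact: cvg_cst.
    by apply/funext => n; rewrite /a/= addr0 mulVf.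
  move=> h1; have : b 0 = 1.
    by apply: (@cvg_unique _ (@norm_hausdorff _ C) _ _ _ _ (ab 0) h1).
  by rewrite b0 => /eqP; rewrite eq_sym oner_eq0.
apply: (@inj u v w b 2 _ b2) => [k|k].
  by split; [have [] := uP k|have [] := vP k|have [] := wP k].
have hj := cvg_jac (k := k) (fun k => proj2 (uP k)) (fun k => proj2 (vP k))
  (fun k => proj2 (wP k)) ab.
apply/eqP; rewrite -modulus_eq0 eq_le modulus_ge0 andbT.
apply/ler_addgt0Pr => e e0; rewrite add0r.
apply: (ulim_modulus_le _ (hj UF)).
apply: sF; near=> n => /=.
have kn : ((absz k).+1 <= n)%N by near: n; exists (absz k).+1.
rewrite (@eq_jac _ _ _ (fun j => (t n).1.1.1.1 (i n + j))
  (fun j => (t n).1.1.1.2 (i n + j)) (fun j => (t n).1.1.2 (i n + j)) _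
  (fun j => (x n (i n))^-1 * x n (i n + j)))//; last 3 first.
- by rewrite /a ifT//; lia.
- by rewrite /a ifT//; lia.
- by rewrite /a ifT//; lia.
rewrite jacZ jac_shift modulusM modulusV mulrC.
rewrite ler_pdivrMr ?lt_def ?modulus_eq0 ?x0 ?modulus_ge0//.
have [_ _ _ /(_ (i n + k))] := tP n.
rewrite addrAC subrr add0r => /(_ (ltnW kn)) h.
(* The failed inequality carries the factor n + 1, which eventually exceeds 1/e; this makes the
   limit of the images vanish. *)
have : 1 <= e * n.+1%:R.
  rewrite -ler_pdivrMl// mulr1 (@le_trans _ _ n%:R) ?ler_nat//.
  near: n; exact: nbhs_infty_ger.
set J := modulus (jac _ _ _ _ _) in h *.
move=> en.
rewrite -(ler_pM2l (ltr0Sn R n)) (le_trans (ltW h))// mulrA.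
by rewrite ler_peMl ?modulus_ge0// mulrC.
Unshelve. all: by end_near. Qed.

(** If the window at [i] yields no bound, it contains an entry more than twice as large; hopping
    there gains a factor 1/2 over a distance of at most [N]. As [x] is bounded, the hops must end
    unless [x i] is 0. *)
Lemma jac_decay : exists N : nat, forall u v w x K i, jac_in u v w ->
  bounded_by x K ->
  exists l, modulus (x i) <=
    N.+1%:R * 2^-1 ^+ (absz (l - i)%R %/ N.+1) * modulus (jac u v w x l).
Proof.
have [N HN] := jac_window; exists N => u v w x K i0 inM xK.
have step (m : nat) : forall i, modulus (x i) <= 2^-1 ^+ m * K \/ exists l, modulus (x i) <=
    N.+1%:R * 2^-1 ^+ (absz (l - i)%R %/ N.+1) * modulus (jac u v w x l).
  elim: m => [i|m IH i]; first by left; rewrite expr0 mul1r.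
  have [xi0|xi0] := eqVneq (x i) 0.
    by right; exists i; rewrite xi0 modulus0 !mulr_ge0 ?modulus_ge0 ?ler0n.
  have [big|] := pselect (forall k, (absz (k - i) <= N)%N ->
    modulus (x k) <= 2 * modulus (x i)).
    have [k kN hk] := HN _ _ _ _ _ inM big xi0.
    by right; exists k; rewrite divn_small ?ltnS// expr0 mulr1.
  move=> /existsNP[k] /not_implyP[kN] /negP; rewrite -ltNge => xk.
  have {}xk : modulus (x i) <= 2^-1 * modulus (x k) by rewrite ler_pdivlMl ?ltW.
  have [h|[l hl]] := IH k; [left|right].
    by rewrite (le_trans xk)// exprS -mulrA ler_wpM2l// invr_ge0.
  exists l; rewrite (le_trans xk)//.
  apply: (@le_trans _ _ (2^-1 * (N.+1%:R * 2^-1 ^+ (absz (l - k)%R %/ N.+1)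
    * modulus (jac u v w x l)))).
    by rewrite ler_wpM2l// invr_ge0.
  rewrite mulrA ler_wpM2r ?modulus_ge0// mulrCA ler_wpM2l// -exprS.
  rewrite ler_wiXn2l ?invr_ge0 ?invf_le1 ?ler1n//.
  (* A hop raises the quotient of the distance by N + 1 by at most one, which its factor 1/2 pays
     for. *)
  have : (absz (l - i) <= absz (l - k)%R + 1 * N.+1)%N by lia.
  by move=> /(leq_div2r N.+1) /leq_trans; apply; rewrite divnDMl// addn1.
have [->|xi0] := eqVneq (x i0) 0.
  by exists i0; rewrite modulus0 !mulr_ge0 ?modulus_ge0 ?ler0n.
apply: contrapT => no.
have {no}hm m : modulus (x i0) <= 2^-1 ^+ m * K by have [//|/no] := step m i0.
have xi : 0 < modulus (x i0) by rewrite lt_def modulus_eq0 xi0 modulus_ge0.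
have K0 : 0 < K by rewrite (lt_le_trans xi).
have : exists m, 2^-1 ^+ m * K < modulus (x i0).
  have : (fun m => (2^-1 : R) ^+ m) @ \oo --> (0 : R).
    by apply: cvg_expr; rewrite gtr0_norm ?invr_gt0// invf_lt1// ltr1n.
  move=> /cvgrPdist_lt/(_ (modulus (x i0) / K)); rewrite divr_gt0//.
  move=> /(_ isT)[m _ /(_ m (leqnn _))] /=.
  rewrite sub0r normrN ger0_norm ?exprn_ge0 ?invr_ge0// ltr_pdivlMr// => ?.
  by exists m.
by move=> [m]; rewrite ltNge hm.
Qed.

End InjectiveOnBounded.
End Jacobi.

Section LpSum.
Variables (R : realType) (p : \bar R) (p1 : (1 <= p)%E).
Local Notation C := (Cplx R).

Lemma lp_le0 (d : measure_display) (I : measurableType d) (dI : discrete I) :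
  lp_le p (fun _ : I => 0 : C) 0.
Proof. by apply: (@lp_le_single _ _ _ _ _ _ point) => //; rewrite modulus0. Qed.

Lemma lp_le_bigsum (d : measure_display) (I : measurableType d) (dI : discrete I)
    (J : Type) (s : seq J) (f : J -> I -> C) (K : J -> R) :
  (forall k, lp_le p (f k) (K k)) ->
  lp_le p (fun i => \sum_(k <- s) f k i) (\sum_(k <- s) K k).
Proof.
move=> h; elim: s => [|k s IH].
  under eq_fun do rewrite big_nil; rewrite big_nil; exact: lp_le0.
under eq_fun do rewrite big_cons; rewrite big_cons.
exact: (lp_leD p1 dI).
Qed.

(** Splitting off the first block of [M] terms, each equal to 1, leaves half of a shorter sum of the
    same kind. *)
Lemma sum_halving_le (M n : nat) : (0 < M)%N ->
  \sum_(k < n) (2^-1 : R) ^+ (k %/ M) <= 2 * M%:R.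
Proof.
move=> M0; elim/ltn_ind: n => n IH.
have [nM|Mn] := leqP n M.
  apply: (@le_trans _ _ (\sum_(k < n) (1 : R))).
    by apply: ler_sum => k _; rewrite exprn_ile1 ?invr_ge0 ?invf_le1 ?ler1n.
  rewrite sumr_const card_ord.
  have : (n%:R : R) <= M%:R by rewrite ler_nat.
  have : (0 : R) <= M%:R by rewrite ler0n.
  rewrite -mulr_natl; lra.
rewrite -(subnKC (ltnW Mn)) big_split_ord/=.
apply: (@le_trans _ _ (M%:R + 2^-1 * \sum_(k < n - M) (2^-1 : R) ^+ (k %/ M))).
  apply: lerD.
    rewrite (eq_bigr (fun=> 1)) ?sumr_const ?card_ord//= => k _.
    by rewrite divn_small.
  rewrite mulr_sumr; apply: ler_sum => k _ /=.
  by rewrite -{1}[X in (X + _)%N]mul1n divnMDl// add1n exprS.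
have := IH (n - M)%N; rewrite ltn_subrL M0 (ltn_trans M0 Mn) => /(_ isT); lra.
Qed.

Lemma lp_le_shift (x : int -> C) (c : int) K :
  lp_le p x K -> lp_le p (fun i : int => x (i + c)) K.
Proof.
apply: (@lp_le_dominated _ _ p1 _ int _ int (+%R^~ c) _ _ _ discrete_int discrete_int) => //.
by move=> i j _ _ /addIr.
Qed.

Lemma lp_le_modulus (d : measure_display) (I : measurableType d) (dI : discrete I)
    (x : I -> C) K :
  lp_le p x K -> lp_le p (fun i => toC (modulus (x i))) K.
Proof.
apply: (lp_le_mono p1 dI) => i; rewrite modulus_toC ger0_norm//; exact: modulus_ge0.
Qed.

Lemma bounded_by_lp (d : measure_display) (I : measurableType d) (dI : discrete I)
    (x : I -> C) K :
  lp_le p x K -> bounded_by x K.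
Proof. by move=> xK i; exact: (lp_le_coord p1 dI). Qed.

End LpSum.

(** * A priori bounds in l^p from exponential decay *)

Section Invertibility.
Variables (R : realType).
Local Notation C := (Cplx R).
Variables U V W : set C.
Hypotheses (cU : compact U) (cV : compact V) (cW : compact W).
Hypothesis inj : jac_injective U V W.
Local Notation jac_in := (jac_in U V W).

(** Decay dominates |x| by a convolution of |y| with a summable kernel, and shifts do not increase
    the l^p norm. The bound [B] is only qualitative: it does not enter [M]. *)
Lemma jac_lower_bound (p : \bar R) (p1 : (1 <= p)%E) : exists2 M : R, 0 <= M &
  forall u v w x B K, jac_in u v w -> bounded_by x B ->
    lp_le p (jac u v w x) K -> lp_le p x (M * K).
Proof.
have [N HN] := jac_decay cU cV cW inj.
(* The decay contributes N + 1, the halving sum 2 (N + 1), and the two directions of the shift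
   another 2. *)
exists (N.+1%:R * 4 * N.+1%:R) => [|u v w x B K inM xB yK].
  by rewrite !mulr_ge0.
have K0 := lp_le_ge0 yK.
set y := jac u v w x in yK.
apply: (lp_le_fatou p1 discrete_int); first by rewrite !mulr_ge0.
move=> s.
have [l lP] := choice (fun i => HN u v w x B i inM xB).
(* On the finite set [s] finitely many shifts suffice, and the final bound does not depend on their
   number. *)
pose L := \max_(i <- s) absz (l i - i).
have lL i : i \in s -> (absz (l i - i) <= L)%N by move=> si; exact: leq_bigmax_seq.
pose q k i := modulus (y (i + k%:Z)) + modulus (y (i - k%:Z)).
pose c k : R := N.+1%:R * 2^-1 ^+ (k %/ N.+1).
pose f k (i : int) : C :=
  toC (c k) * (toC (modulus (y (i + k%:Z))) + toC (modulus (y (i - k%:Z)))).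
have fE k i : f k i = toC (c k * q k i) by rewrite /f -toCD -toCM.
have c0 k : 0 <= c k by rewrite mulr_ge0.
have f0 k i : 0 <= c k * q k i by rewrite mulr_ge0// addr_ge0 ?modulus_ge0.
have : lp_le p (fun i => \sum_(k < L.+1) f k i) (\sum_(k < L.+1) c k * (K + K)).
  apply: (lp_le_bigsum p1 discrete_int) => k.
  rewrite -[X in lp_le _ _ (X * _)](ger0_norm (c0 k)) -modulus_toC.
  apply: (lp_leZ p1 discrete_int); apply: (lp_leD p1 discrete_int);
    apply: (lp_le_modulus p1 discrete_int); exact: lp_le_shift.
rewrite -mulr_suml -mulr_sumr => h.
have {h} : lp_le p (fun i => \sum_(k < L.+1) f k i) (N.+1%:R * 4 * N.+1%:R * K).
  apply: lp_leW h; have := sum_halving_le R L.+1 (ltn0Sn N).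
  set S := (\sum_(_ < _) _) => hS.
  rewrite (_ : N.+1%:R * 4 * N.+1%:R * K = N.+1%:R * (2 * N.+1%:R) * (K + K)); last by ring.
  by rewrite ler_wpM2r ?addr_ge0// ler_wpM2l.
apply: (lp_le_mono p1 discrete_int) => i.
have SE : \sum_(k < L.+1) f k i = toC (\sum_(k < L.+1) c k * q k i).
  by elim/big_rec2: _ => // k a b _ ->; rewrite fE toCD.
rewrite SE modulus_toC; apply: le_trans (ler_norm _).
case: ifPn => si; last by rewrite modulus0 sumr_ge0.
have lt : (absz (l i - i) < L.+1)%N by rewrite ltnS lL.
rewrite (bigD1 (Ordinal lt))//= -[leLHS]addr0 lerD ?sumr_ge0//.
apply: le_trans (lP i) _; rewrite ler_wpM2l// -/y /q /=.
have [h|h] := leP 0 (l i - i).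
  by rewrite (_ : i + Posz (absz (l i - i)%R) = l i) ?lerDl ?modulus_ge0//; lia.
by rewrite (_ : i - Posz (absz (l i - i)%R) = l i) ?lerDr ?modulus_ge0//; lia.
Qed.

End Invertibility.

(** * Periodization with period 2n + 1, and surjectivity *)

Section Periodization.
Variable n : nat.

(** The integers from -n to n represent the residues modulo 2n + 1; index [j] of the finite system
    stands for the integer j - n. *)
Definition window_residue (k : int) : 'I_(n + n).+1 :=
  inord (absz ((k + n%:Z) %% (n + n).+1%:Z)%Z).

Definition window_point (j : 'I_(n + n).+1) : int := j%:Z - n%:Z.

Lemma window_pointK : cancel window_point window_residue.
Proof.
move=> j; apply: val_inj; rewrite /window_residue /window_point /= subrK.
by rewrite modz_small ?inordK ?absz_nat//= ltz_nat ltn_ord.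
Qed.

Lemma window_pointE k : window_point (window_residue k) =
  ((k + n%:Z) %% (n + n).+1%:Z)%Z - n%:Z.
Proof.
have m0 : 0 <= ((k + n%:Z) %% (n + n).+1%:Z)%Z by rewrite modz_ge0.
have := @ltz_pmod (k + n%:Z) (n + n).+1%:Z isT.
rewrite /window_point /window_residue => h.
rewrite inordK; last by rewrite -ltz_nat gez0_abs.
by rewrite gez0_abs.
Qed.

Lemma window_residueK k : (absz k <= n)%N -> window_point (window_residue k) = k.
Proof.
move=> kn; rewrite window_pointE modz_small ?addrK//.
by apply/andP; split; lia.
Qed.

Lemma window_residueD k c :
  window_residue (window_point (window_residue k) + c) = window_residue (k + c).
Proof.
rewrite {1}/window_residue window_pointE /window_residue; congr (inord (absz _)).
rewrite (_ : _ - n%:Z + c + n%:Z = ((k + n%:Z) %% (n + n).+1%:Z)%Z + c); last by ring.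
by rewrite modzDml; congr modz; ring.
Qed.

End Periodization.

Section Surjectivity.
Variables (R : realType).
Local Notation C := (Cplx R).
Variables U V W : set C.
Hypotheses (cU : compact U) (cV : compact V) (cW : compact W).
Hypothesis inj : jac_injective U V W.
Local Notation jac_in := (jac_in U V W).

(** Periodic sequences are bounded and the periodised diagonals stay in U, V, W, so injectivity on
    bounded sequences makes a square matrix injective, hence invertible. *)
Lemma jac_solve_periodic (n : nat) u v w y (K : R) : jac_in u v w -> bounded_by y K ->
  let per (z : int -> C) k := z (window_point (window_residue n k)) in
  exists x B, bounded_by x B /\
    forall k, jac (per u) (per v) (per w) x k = per y k.
Proof.
move=> inM yK per.
pose P := (n + n).+1; pose rho := @window_residue n; pose pi := @window_point n.
(* The three coefficients are added because their columns coincide when [n] is 0. *)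
pose A := \matrix_(j < P, i < P)
  (u (pi j) * (i == rho (pi j - 1))%:R + v (pi j) * (i == j)%:R
   + w (pi j) * (i == rho (pi j + 1))%:R).
pose ext (z : 'cV[C]_P) k := z (rho k) 0.
have jacA z k : jac (per u) (per v) (per w) (ext z) k = (A *m z) (rho k) 0.
  rewrite !mxE /jac /per /ext.
  have pick (c : C) (a : 'I_P) : \sum_i c * (i == a)%:R * z i 0 = c * z a 0.
    rewrite (bigD1 a)//= eqxx mulr1 big1 ?addr0// => i /negPf ->.
    by rewrite mulr0 mul0r.
  under eq_bigr do rewrite mxE !mulrDl.
  by rewrite !big_split/= !pick /rho /pi !window_residueD.
have ext_bounded z : bounded_by (ext z) (\sum_i modulus (z i 0)).
  move=> k; rewrite /ext (bigD1 (rho k))//= lerDl sumr_ge0// => i _.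
  exact: modulus_ge0.
have perM : jac_in (per u) (per v) (per w) by move=> k; exact: inM.
have Aunit : A \in unitmx.
  rewrite -unitmx_tr -row_free_unit; apply: inj_row_free => z zA.
  have Az : A *m z^T = 0 by rewrite -[A]trmxK -trmx_mul zA trmx0.
  apply: trmx_inj; apply/matrixP => i j; rewrite ord1 trmx0 [RHS]mxE.
  have := @inj _ _ _ (ext z^T) _ perM (ext_bounded _).
  rewrite /ext -[i in LHS](@window_pointK n); apply => k.
  by rewrite jacA Az mxE.
pose b : 'cV[C]_P := \col_j y (pi j).
exists (ext (invmx A *m b)), (\sum_i modulus ((invmx A *m b) i 0)); split.
  exact: ext_bounded.
by move=> k; rewrite jacA mulKVmx// mxE.
Qed.

(* Solve periodised equations, with a bound independent of the period, and take an
   ultralimit. *)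
Lemma jac_surjective u v w y (K : R) : jac_in u v w -> bounded_by y K ->
  exists x B, bounded_by x B /\ forall k, jac u v w x k = y k.
Proof.
move=> inM yK.
have [M M0 HM] := jac_lower_bound cU cV cW inj (leey (1%E : \bar R)).
have K0 : 0 <= K by rewrite (le_trans _ (yK 0)) ?modulus_ge0.
pose per n (z : int -> C) k := z (window_point (window_residue n k)).
have ex n : exists x, bounded_by x (M * K) /\
    forall k, jac (per n u) (per n v) (per n w) x k = per n y k.
  have [x [B [xB xy]]] := jac_solve_periodic n inM yK.
  exists x; split => //.
  apply/(lp_norm_ooP discrete_int _ (mulr_ge0 M0 K0)).
  have perM : jac_in (per n u) (per n v) (per n w) by move=> k; exact: inM.
  apply: (HM _ _ _ _ _ _ perM xB); apply/(lp_norm_ooP discrete_int _ K0) => k.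
  by rewrite xy; exact: yK.
have [xn xnP] := choice ex.
have [F [UF sF]] := ultraFilterLemma eventually_filter.
have [x xP] := choice (fun k => ulim_bounded (fun n => (xnP n).1 k)).
exists x, (M * K); split => k.
  apply: (ulim_modulus_le _ (xP k)).
  by apply: (@filterS _ F _ setT) => [n _ /=|]; [exact: (xnP n).1|exact: filterT].
have perE (z : int -> C) i : (fun n => per n z i) @ F --> z i.
  apply: (@cvg_trans _ (cst (z i) @ F)); last exact: cvg_cst.
  apply: near_eq_cvg; apply: sF; exists (absz i) => // m /= im.
  by rewrite /per window_residueK.
have := cvg_jac (k := k) (perE u) (perE v) (perE w) xP.
rewrite (_ : (fun n => _) = (fun n => per n y k)); last first.
  by apply/funext => n; rewrite (xnP n).2.
move=> h.
exact: (@cvg_unique _ (@norm_hausdorff _ C) _ _ _ _ (h UF) (perE y k)).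
Qed.

End Surjectivity.

(** * From matrices to tridiagonal operators *)

Section Operators.
Variables (R : realType).
Local Notation C := (Cplx R).

Lemma lp_fin p (d : measure_display) (I : measurableType d) (x : I -> C) :
  lp p x -> exists2 K, lp_norm p x = K%:E & lp_le p x K.
Proof.
move=> xp; have x0 : (0 <= lp_norm p x)%E by exact: Lnorm_ge0.
exists (fine (lp_norm p x)).
  by rewrite fineK// ge0_fin_numE.
by rewrite /lp_le fineK// ge0_fin_numE.
Qed.

Lemma lp_leP p (d : measure_display) (I : measurableType d) (x : I -> C) :
  lp p x <-> exists K, lp_le p x K.
Proof.
split=> [/lp_fin[K _ xK]|[K xK]]; first by exists K.
by apply: le_lt_trans xK _; rewrite ltry.
Qed.

Lemma mulmv_seq (d : measure_display) (I : measurableType d)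
    (B : I -> I -> C) x i (s : seq I) : uniq s ->
  (forall j, j \notin s -> B i j = 0) ->
  mulmv B x i = \sum_(j <- s) B i j * x j.
Proof.
move=> us Bs; rewrite /mulmv (fsbigE s)//=.
- by apply: eq_bigl => j; rewrite in_setT.
- by move=> j _ /Bs ->; rewrite mul0r.
Qed.

Definition subdiag (A : int -> int -> C) k := A k (k - 1).
Definition maindiag (A : int -> int -> C) k := A k k.
Definition superdiag (A : int -> int -> C) k := A k (k + 1).

Lemma shifted_op_jac (U V W : set C) A lam : M_bi U V W A ->
  shifted_op A lam = jac (subdiag A) (fun k => maindiag A k - lam) (superdiag A).
Proof.
move=> AM; apply/funext => x; apply/funext => k.
rewrite /shifted_op fctE.
rewrite (@mulmv_seq _ _ A x k [:: k - 1; k; k + 1]).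
- rewrite /jac !big_cons big_nil addr0 /subdiag /maindiag /superdiag.
  rewrite (_ : (- (lam *: x)) k = - (lam * x k))//; ring.
- by rewrite /= !inE; apply/and3P; split => //; lia.
- move=> j; rewrite !inE => jk; have [_ _ _] := AM k j; apply.
  move: jk; rewrite !negb_or => /and3P[/eqP ? /eqP ? /eqP ?]; lia.
Qed.

Definition bi_matrix (u v w : int -> C) : int -> int -> C := fun i j =>
  if j == i - 1 then u i else if j == i then v i else if j == i + 1 then w i else 0.

Lemma M_bi_matrix (U V W : set C) u v w :
  (forall k, [/\ U (u k), V (v k) & W (w k)]) -> M_bi U V W (bi_matrix u v w).
Proof.
move=> inM i j; have [Ui Vi Wi] := inM i; rewrite /bi_matrix; split => /= h.
- by rewrite h eqxx.
- by have [e|] := eqVneq j (i - 1); [lia|rewrite h eqxx].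
- have [e|_] := eqVneq j (i - 1); first lia.
  by have [e|_] := eqVneq j i; [lia|rewrite h eqxx].
- have [e|_] := eqVneq j (i - 1); first lia.
  have [e|_] := eqVneq j i; first lia.
  by have [e|_] := eqVneq j (i + 1); first lia.
Qed.

Lemma bi_matrixE u v w :
  [/\ subdiag (bi_matrix u v w) = u, maindiag (bi_matrix u v w) = v &
      superdiag (bi_matrix u v w) = w].
Proof.
split; apply/funext => k; rewrite /subdiag /maindiag /superdiag /bi_matrix.
- by rewrite eqxx.
- by have [e|_] := eqVneq k (k - 1); [lia|rewrite eqxx].
- have [e|_] := eqVneq (k + 1) (k - 1); first lia.
  by have [e|_] := eqVneq (k + 1) k; [lia|rewrite eqxx].
Qed.

Lemma compact_modulus_le (A : set C) : compact A ->
  exists2 K, 0 <= K & forall z, A z -> modulus z <= K.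
Proof.
move=> cA; apply: contrapT => no.
have /choice[a aP] : forall n : nat, exists z : C, A z /\ n%:R < modulus z.
  move=> n; apply: contrapT => non; apply: no; exists n%:R => // z Az.
  by rewrite leNgt; apply/negP => h; apply: non; exists z.
have [F [UF sF]] := ultraFilterLemma eventually_filter.
have [l _ /cvg_modulusP/(_ _ ltr01) h] := ulim_compact cA (fun n => (aP n).1).
have h2 : F [set n : nat | 1 + modulus l <= n%:R] by apply: sF; exact: nbhs_infty_ger.
have [n [/= h3 h4]] := @filter_ex _ _ _ _ (filterI h h2).
have := (aP n).2; rewrite ltNge (le_trans _ h4)//.
rewrite -[a n](subrK l) (le_trans (modulusD _ _))// lerD2r modulus_distrC.
exact: ltW.
Qed.

(** Serves both for the boundedness of tridiagonal operators and for the errors of approximate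
    kernel vectors. *)
Lemma lp_le_neighbours p (p1 : (1 <= p)%E) (z x : int -> C) (c K : R) : 0 <= c ->
  (forall k, modulus (z k) <=
     c * (modulus (x (k - 1)) + modulus (x k) + modulus (x (k + 1)))) ->
  lp_le p x K -> lp_le p z (c * (3 * K)).
Proof.
move=> c0 zx xK.
have h : lp_le p (fun k : int => toC (modulus (x (k - 1))) + toC (modulus (x k))
    + toC (modulus (x (k + 1)))) (K + K + K).
  by apply: (lp_leD p1 discrete_int); [apply: (lp_leD p1 discrete_int)|];
     apply: (lp_le_modulus p1 discrete_int) => //; exact: lp_le_shift.
have := lp_leZ p1 discrete_int (toC c) h.
rewrite modulus_toC ger0_norm// (_ : K + K + K = 3 * K); last by ring.
apply: (lp_le_mono p1 discrete_int) => k.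
rewrite (le_trans (zx k))// -!toCD -toCM modulus_toC; exact: ler_norm.
Qed.

(** Absorbs the spectral parameter into the main diagonal, so that B - lam belongs to a class of the
    same form. *)
Definition shifted_set (V : set C) (lam : C) : set C := [set v - lam | v in V].

Lemma compact_shifted V lam : compact V -> compact (shifted_set V lam).
Proof.
move=> cV; apply: continuous_compact => //.
apply: continuous_subspaceT => z.
by apply: (@cvgB C C _ (nbhs z) _ id (cst lam)); [exact: cvg_id|exact: cvg_cst].
Qed.

Lemma M_bi_jac_in (U V W : set C) A lam : M_bi U V W A ->
  jac_in U (shifted_set V lam) W (subdiag A) (fun k => maindiag A k - lam)
    (superdiag A).
Proof.
move=> AM k; split.
- by have [h _ _ _] := AM k (k - 1); apply: h.
- by exists (maindiag A k) => //; have [_ h _ _] := AM k k; apply: h.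
- by have [_ _ h _] := AM k (k + 1); apply: h.
Qed.

Variable p : \bar R.
Hypothesis p1 : (1 <= p)%E.

Lemma invertible_fredholm (d : measure_display) (I : measurableType d)
    (dI : discrete I) (B : I -> I -> C) lam :
  (forall i, exists s : seq I, uniq s /\ forall j, j \notin s -> B i j = 0) ->
  invertible_on p (shifted_op B lam) -> fredholm_on p (shifted_op B lam).
Proof.
move=> Bfin [S [SX _ ST TS]].
have T0 : shifted_op B lam 0 = 0.
  apply/funext => i; rewrite /shifted_op fctE.
  have [s [us hs]] := Bfin i; rewrite (mulmv_seq _ us hs) big1 => [|j _].
    by rewrite scaler0 subr0.
  by rewrite mulr0.
have lp0 : lp p (0 : I -> C) by apply/lp_leP; exists 0; exact: lp_le0.
split.
  exists 0, (fun=> 0); split => [[]//|x [xp /= Tx]].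
  (* [S] is not given as linear, so a kernel vector is compared with 0 through [S (T 0) = 0]. *)
  exists (fun=> 0); rewrite big_ord0 -(ST _ xp) Tx -[in LHS]T0 ST//.
exists 0, (fun=> 0); split => [[]//|y yp].
exists y; first by exists (S y); [exact: SX|exact: TS].
by exists (fun=> 0); rewrite big_ord0 addr0.
Qed.

Section Bounded.
Variables U V W : set C.
Hypotheses (cU : compact U) (cV : compact V) (cW : compact W).

Lemma jac_modulus_le : exists2 c, 0 <= c & forall u v w x k, jac_in U V W u v w ->
  modulus (jac u v w x k) <=
     c * (modulus (x (k - 1)) + modulus (x k) + modulus (x (k + 1))).
Proof.
have [a a0 Ua] := compact_modulus_le cU.
have [b b0 Vb] := compact_modulus_le cV.
have [c c0 Wc] := compact_modulus_le cW.
exists (a + b + c) => [|u v w x k inM]; first by rewrite !addr_ge0.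
have [/Ua h1 /Vb h2 /Wc h3] := inM k.
rewrite /jac !mulrDr; apply: (le_trans (modulusD _ _)); apply: lerD.
  apply: (le_trans (modulusD _ _)); apply: lerD.
    by rewrite modulusM ler_wpM2r ?modulus_ge0//; lra.
  by rewrite modulusM ler_wpM2r ?modulus_ge0//; lra.
by rewrite modulusM ler_wpM2r ?modulus_ge0//; lra.
Qed.

Lemma jac_lp u v w x : jac_in U V W u v w -> lp p x -> lp p (jac u v w x).
Proof.
move=> inM /lp_fin[K _ xK]; have [c c0 hc] := jac_modulus_le.
apply/lp_leP; exists (c * (3 * K)).
by apply: (lp_le_neighbours p1 c0 _ xK) => k; exact: hc.
Qed.

End Bounded.

Section Invertible.
Variables U V W : set C.
Hypotheses (cU : compact U) (cV : compact V) (cW : compact W).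
Hypothesis inj : jac_injective U V W.

(** The equation is solved among bounded sequences, which contain every l^p; the lower bound then
    puts the solution in l^p, and injectivity on bounded sequences makes it unique. *)
Lemma jac_invertible u v w : jac_in U V W u v w -> invertible_on p (jac u v w).
Proof.
move=> inM.
have [M M0 HM] := jac_lower_bound cU cV cW inj p1.
have ex y : exists x, lp p y ->
    [/\ exists B, bounded_by x B, jac u v w x = y &
        (lp_norm p x <= M%:E * lp_norm p y)%E].
  have [/lp_fin[K yE yK]|ny] := pselect (lp p y); last by exists 0 => /ny.
  have [x [B [xB xy]]] :=
    jac_surjective cU cV cW inj inM (bounded_by_lp p1 discrete_int yK).
  have {}xy : jac u v w x = y by apply/funext.
  exists x => _; split => //; first by exists B.
  by rewrite yE -EFinM; apply: (HM _ _ _ _ _ _ inM xB); rewrite xy.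
have [S SP] := choice ex.
have Slp y : lp p y -> lp p (S y).
  move=> yp; have [_ _] := SP y yp; have [K -> _] := lp_fin yp => h.
  by apply/lp_leP; exists (M * K).
have uniq x x' B B' : bounded_by x B -> bounded_by x' B' ->
    jac u v w x = jac u v w x' -> x = x'.
  move=> xB xB' xx'; apply/funext => k; apply/eqP; rewrite -subr_eq0; apply/eqP.
  apply: (@inj u v w (fun k => x k - x' k) (B + B') inM).
    by move=> j; apply: (le_trans (modulusB _ _)); apply: lerD; [exact: xB|exact: xB'].
  by move=> j; rewrite jacB xx' subrr.
exists S; split => //.
- by exists M => y yp; have [] := SP y yp.
- move=> x xp.
  have Txp := jac_lp cU cV cW inM xp.
  have [[B xB] h _] := SP _ Txp; have [K _ xK] := lp_fin xp.
  exact: uniq xB (bounded_by_lp p1 discrete_int xK) h.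
- by move=> y /SP[].
Qed.

End Invertible.

End Operators.

(** * Approximate kernels and Fredholm operators *)

(* The Baire category theorem for closed subsets of the Cantor space. *)
Lemma cantor_baire (E : nat -> (nat -> bool) -> Prop) :
  (forall n b, (forall k, exists b', (forall j, (j < k)%N -> b' j = b j) /\ E n b') ->
     E n b) ->
  (forall b, exists n, E n b) ->
  exists n k b0, forall b, (forall j, (j < k)%N -> b j = b0 j) -> E n b.
Proof.
move=> Ecl Eall; apply: contrapT => no.
have step n (q : (nat -> bool) * nat) : exists q' : (nat -> bool) * nat,
    [/\ (q.2 < q'.2)%N, forall j, (j < q.2)%N -> q'.1 j = q.1 j &
        forall b, (forall j, (j < q'.2)%N -> b j = q'.1 j) -> ~ E n b].
  have [b [bq nEb]] : exists b, (forall j, (j < q.2)%N -> b j = q.1 j) /\ ~ E n b.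
    apply: contrapT => h; apply: no; exists n, q.2, q.1 => b bq.
    by apply: contrapT => nE; apply: h; exists b.
  have [k hk] : exists k, forall b', (forall j, (j < k)%N -> b' j = b j) -> ~ E n b'.
    apply: contrapT => h; apply: nEb; apply: Ecl => k.
    apply: contrapT => h'; apply: h; exists k => b' bb' Eb'.
    by apply: h'; exists b'.
  (* Prefix lengths are made to grow strictly, so that the prefixes determine an infinite
     sequence. *)
  exists (b, maxn k q.2.+1); split => //=; first by rewrite leq_max ltnS leqnn orbT.
  by move=> b' bb'; apply: hk => j jk; apply: bb'; rewrite leq_max jk.
have /choice[f fP] : forall nq : nat * ((nat -> bool) * nat),
    exists q' : (nat -> bool) * nat,
    [/\ (nq.2.2 < q'.2)%N, forall j, (j < nq.2.2)%N -> q'.1 j = nq.2.1 j &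
        forall b, (forall j, (j < q'.2)%N -> b j = q'.1 j) -> ~ E nq.1 b].
  by move=> [n q]; exact: step.
pose q := fix q n := if n is n'.+1 then f (n', q n') else ((fun=> false), 0%N).
have qge n : (n <= (q n).2)%N.
  elim: n => // n IH; apply: leq_ltn_trans IH _ => /=.
  by have [] := fP (n, q n).
have qmono l m : (l <= m)%N -> ((q l).2 <= (q m).2)%N /\
    forall j, (j < (q l).2)%N -> (q m).1 j = (q l).1 j.
  elim: m => [|m IH]; first by rewrite leqn0 => /eqP ->.
  rewrite leq_eqVlt => /orP[/eqP->//|]; rewrite ltnS => /IH[h1 h2].
  have [/= h3 h4 _] := fP (m, q m); split; first exact: leq_trans h1 (ltnW h3).
  by move=> j jl; rewrite h4 ?h2//; exact: leq_trans jl h1.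
pose b j := (q j.+1).1 j.
have bq n j : (j < (q n).2)%N -> b j = (q n).1 j.
  move=> jn; rewrite /b; have [h|h] := leqP j.+1 n.
    by rewrite (qmono _ _ h).2// (leq_trans _ (qge j.+1)).
  by rewrite (qmono _ _ (ltnW h)).2.
have [n En] := Eall b.
by have [_ _ /(_ b)] := fP (n, q n); apply => // j jn; exact: (bq n.+1).
Qed.

Section Dependence.
Variable K : fieldType.

Lemma exists_left_kernel (m N : nat) (D : 'M[K]_(N, m)) : (m < N)%N ->
  exists2 t : 'rV[K]_N, t != 0 & t *m D = 0.
Proof.
move=> mN; have : kermx D != 0.
  by rewrite -mxrank_eq0 mxrank_ker subn_eq0 -ltnNge (leq_ltn_trans (rank_leq_col D)).
move=> /rowV0Pn[t tD t0]; exists t => //; exact/sub_kermxP.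
Qed.

End Dependence.

Section LpSums.
Variables (R : realType) (p : \bar R) (p1 : (1 <= p)%E).
Local Notation C := (Cplx R).
Variables (d : measure_display) (I : measurableType d) (dI : discrete I).

Lemma lp_lincomb (J : finType) (f : J -> I -> C) (c : J -> C) :
  (forall k, lp p (f k)) -> lp p (fun i => \sum_k c k * f k i).
Proof.
move=> /(_ _)/lp_fin/cid2-/all_sig2[K _ hK].
apply/lp_leP; exists (\sum_k modulus (c k) * K k).
by apply: (lp_le_bigsum p1 dI) => k; exact: (lp_leZ p1 dI).
Qed.

End LpSums.

(** * Operators with finite rows and sums of approximate kernel vectors *)

Section FiniteRows.
Variables (R : realType) (p : \bar R) (p1 : (1 <= p)%E).
Local Notation C := (Cplx R).
Variables (d : measure_display) (I : measurableType d) (dI : discrete I).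
Variable T : (I -> C) -> (I -> C).
(** Rows as finite lists of pairs (column, coefficient) make [T] linear and continuous for pointwise
    limits, also on vectors outside l^p. *)
Variable row : I -> seq (I * C).
Hypothesis TE : forall x i, T x i = \sum_(q <- row i) q.2 * x q.1.

Lemma finrow_local x x' i : (forall q, q \in row i -> x q.1 = x' q.1) -> T x i = T x' i.
Proof. by move=> h; rewrite !TE; apply: eq_big_seq => q /h ->. Qed.

Lemma finrow_lincomb (J : Type) (s : seq J) (c : J -> C) (f : J -> I -> C) i :
  T (fun i => \sum_(k <- s) c k * f k i) i = \sum_(k <- s) c k * T (f k) i.
Proof.
rewrite TE; under eq_bigr do rewrite mulr_sumr.
rewrite exchange_big/=; apply: eq_bigr => k _; rewrite TE mulr_sumr.
by apply: eq_bigr => q _; rewrite mulrCA.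
Qed.

Lemma finrowB x y i : T (fun i => x i - y i) i = T x i - T y i.
Proof. by rewrite !TE -sumrB; apply: eq_bigr => q _; rewrite mulrBr. Qed.

Lemma finrowZ (c : C) x i : T (fun i => c * x i) i = c * T x i.
Proof. by rewrite !TE mulr_sumr; apply: eq_bigr => q _; rewrite mulrCA. Qed.

Lemma cvg_bigsum (F : set_system nat) {FF : Filter F} (J : Type) (s : seq J)
    (f : nat -> J -> C) (g : J -> C) :
  (forall k, (fun n => f n k) @ F --> g k) ->
  (fun n => \sum_(k <- s) f n k) @ F --> \sum_(k <- s) g k.
Proof.
move=> h; elim: s => [|k s IH].
  by under eq_fun do rewrite big_nil; rewrite big_nil; exact: cvg_cst.
under eq_fun do rewrite big_cons; rewrite big_cons.
by apply: cvgD; [exact: h|exact: IH].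
Qed.

Lemma finrow_cvg (F : set_system nat) {FF : Filter F} (xn : nat -> I -> C) x i :
  (forall j, (fun n => xn n j) @ F --> x j) -> (fun n => T (xn n) i) @ F --> T x i.
Proof.
move=> h; under eq_fun do rewrite TE; rewrite TE.
by apply: cvg_bigsum => q; apply: cvgM; [exact: cvg_cst|exact: h].
Qed.

Lemma lp_le_restrict (s : seq I) (z : I -> C) :
  lp_le p (fun i => if i \in s then z i else 0) (\sum_(i <- s) modulus (z i)).
Proof.
pose f k i : C := if i == k then toC (modulus (z k)) else 0.
have h : lp_le p (fun i => \sum_(k <- s) f k i) (\sum_(k <- s) modulus (z k)).
  apply: (lp_le_bigsum p1 dI) => k; apply: (lp_le_single p1 dI (i := k)).
    by rewrite /f eqxx modulus_toC ger0_norm ?modulus_ge0.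
  by move=> j /negPf jk; rewrite /f jk.
apply: (lp_le_mono p1 dI) h => i.
have fE k : f k i = toC (if i == k then modulus (z k) else 0).
  by rewrite /f; case: ifP.
have -> : \sum_(k <- s) f k i = toC (\sum_(k <- s) if i == k then modulus (z k) else 0).
  by elim/big_rec2: _ => // k a b _ ->; rewrite fE toCD.
have f0 (k : I) : 0 <= (if i == k then modulus (z k) else 0).
  by case: ifP => // _; exact: modulus_ge0.
rewrite modulus_toC; apply: le_trans (ler_norm _); case: ifPn => si.
  by rewrite (big_rem i)//= eqxx lerDl sumr_ge0.
by rewrite modulus0 sumr_ge0.
Qed.

Lemma filter_all_seq (F : set_system nat) {FF : Filter F} (J : eqType) (s : seq J)
    (P : J -> set nat) :
  (forall k, F (P k)) -> F [set n | forall k, k \in s -> P k n].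
Proof.
move=> h; elim: s => [|k s IH].
  by apply: (@filterS _ F _ setT) => //; exact: filterT.
apply: filterS2 (h k) IH => n Pk Ps l; rewrite inE => /orP[/eqP->//|]; exact: Ps.
Qed.

(** On a finite set of places the limit differs in norm from some member of the sequence by at most
    [e], and finite restrictions decide membership in a ball. *)
Lemma lp_le_ulim (F : set_system nat) {UF : UltraFilter F} (xn : nat -> I -> C) x K :
  (forall j, (fun n => xn n j) @ F --> x j) -> (forall n, lp_le p (xn n) K) ->
  lp_le p x K.
Proof.
move=> xnx xnK; have K0 := lp_le_ge0 (xnK 0%N).
apply: (lp_le_fatou p1 dI K0) => s.
rewrite /lp_le; apply/lee_addgt0Pr => e e0; rewrite -EFinD.
have N0 : 0 < e / (size s).+1%:R by rewrite divr_gt0.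
have h1 j : F [set n | modulus (x j - xn n j) < e / (size s).+1%:R].
  by have /cvg_modulusP := xnx j; apply.
have [n hn] := @filter_ex _ _ _ _ (@filter_all_seq F _ _ s _ h1).
have a1 : lp_le p (fun i => if i \in s then xn n i else 0) K.
  apply: (lp_le_mono p1 dI) (xnK n) => i; case: ifP => // _.
  by rewrite modulus0 modulus_ge0.
have a2 := lp_le_restrict s (fun i => x i - xn n i).
have := lp_leD p1 dI a1 a2; move/(lp_le_mono p1 dI) => a3.
have {a3}: lp_le p (fun i => if i \in s then x i else 0)
    (K + \sum_(i <- s) modulus (x i - xn n i)).
  by apply: a3 => i /=; case: ifP => _; rewrite ?addr0// addrC subrK.
apply: lp_leW; rewrite lerD2l.
apply: (@le_trans _ _ (\sum_(i <- s) e / (size s).+1%:R)).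
  by rewrite big_seq [leRHS]big_seq; apply: ler_sum => i /hn/ltW.
rewrite big_const_seq count_predT iter_addr_0 -[leLHS]mulr_natl mulrCA ger_pMr//.
by rewrite ler_pdivrMr// mul1r ler_nat.
Qed.

Variable y : nat -> I -> C.
Hypothesis y_disj : forall j k i, y j i != 0 -> y k i != 0 -> j = k.
Hypothesis y_loc : forall i, exists m, forall j, (m <= j)%N -> y j i = 0.
Hypothesis y_big : forall j, ~ lp_le p (y j) 2^-1.
Hypothesis y_lp : forall j, lp p (y j).
Hypothesis Ty_small : forall j, lp_le p (T (y j)) (4^-1 ^+ j).

(** At each place the sum is finite, so [Y b] is defined without being in l^p; its image is, because
    2^j times 4^-j is summable. *)
Lemma weyl_sequence_sums : exists Y : (nat -> bool) -> I -> C,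
  (forall b, lp p (T (Y b))) /\
  forall i, exists M, forall b n, (M <= n)%N ->
    Y b i = \sum_(j < n) (b j)%:R * 2 ^+ j * y j i.
Proof.
have /choice[m mP] := y_loc.
pose Y (b : nat -> bool) i := \sum_(j < m i) (b j)%:R * 2 ^+ j * y j i.
have YE b i n : (m i <= n)%N -> Y b i = \sum_(j < n) (b j)%:R * 2 ^+ j * y j i.
  move=> mn; rewrite -(subnKC mn) big_split_ord/= [X in _ + X]big1 ?addr0// => k _.
  by rewrite mP ?mulr0// leq_addr.
exists Y; split => [b|]; last by move=> i; exists (m i) => b n; exact: YE.
apply/lp_leP; exists 2; apply: (lp_le_fatou p1 dI) => // s.
(* From [n] on, no y_j meets a column occurring in the rows of [s]. *)
pose n := \max_(i <- s) \max_(q <- row i) m q.1.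
have TY i : i \in s -> T (Y b) i = \sum_(j < n) (b j)%:R * 2 ^+ j * T (y j) i.
  move=> si; rewrite -finrow_lincomb; apply: finrow_local => q qi.
  apply: YE.
  have h1 : (m q.1 <= \max_(q <- row i) m q.1)%N.
    exact: (@leq_bigmax_seq _ (row i) xpredT (fun q => m q.1)).
  apply: leq_trans h1 _.
  exact: (@leq_bigmax_seq _ s xpredT (fun i => \max_(q <- row i) m q.1)).
have h : lp_le p (fun i => \sum_(j < n) (b j)%:R * 2 ^+ j * T (y j) i)
    (\sum_(j < n) (2^-1 : R) ^+ j).
  apply: (lp_le_bigsum p1 dI) => j.
  have hj := lp_leZ p1 dI ((b j)%:R * 2 ^+ j) (Ty_small j).
  apply: lp_leW hj.
  rewrite modulusM (_ : (2 : C) ^+ j = toC (2 ^+ j)); last first.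
    by rewrite /toC rmorphXn/= rmorph_nat.
  rewrite modulus_toC ger0_norm ?exprn_ge0// -mulrA -exprMn.
  rewrite (_ : 2 * 4^-1 = 2^-1 :> R); last by field.
  by case: (b j); rewrite ?modulus1 ?modulus0 ?mul1r ?mul0r.
apply: lp_leW; last first.
  apply: (lp_le_mono p1 dI) h => i; case: ifPn => [si|_]; first by rewrite TY.
  by rewrite modulus0 modulus_ge0.
have := sum_halving_le R n (ltn0Sn 0); rewrite mulr1.
by under eq_bigr do rewrite divn1.
Qed.

End FiniteRows.

(** * Failure of the Fredholm property *)

Section NotFredholm.
Variables (R : realType) (p : \bar R) (p1 : (1 <= p)%E).
Local Notation C := (Cplx R).
Variables (d : measure_display) (I : measurableType d) (dI : discrete I).
Variable T : (I -> C) -> (I -> C).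
Variable row : I -> seq (I * C).
Hypothesis TE : forall x i, T x i = \sum_(q <- row i) q.2 * x q.1.

Section Sequence.
Variable y : nat -> I -> C.
Hypothesis y_disj : forall j k i, y j i != 0 -> y k i != 0 -> j = k.
Hypothesis y_loc : forall i, exists m, forall j, (m <= j)%N -> y j i = 0.
Hypothesis y_big : forall j, ~ lp_le p (y j) 2^-1.
Hypothesis y_lp : forall j, lp p (y j).
Hypothesis Ty_small : forall j, lp_le p (T (y j)) (4^-1 ^+ j).

(* Let [E n] be the set of all [b] for which [T (Y b)] is [T x] plus a combination of
   the [v k] with all data bounded by [n]. It is closed, so some [E n] contains a
   cylinder; two of its members that differ only in the entry [j] are subtracted. *)
Lemma weyl_sequence_cylinder (m : nat) (v : 'I_m -> I -> C) :
  (forall x, lp p x -> exists2 z, (T @` lp p) z &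
      exists c : 'I_m -> C, x = z + \sum_(k < m) c k *: v k) ->
  exists (n j0 : nat), forall j, (j0 <= j)%N -> exists x c, lp_le p x (n + n)%:R /\
    forall i, 2 ^+ j * T (y j) i = T x i + \sum_(k < m) c k * v k i.
Proof.
move=> codim.
have [Y [Ylp hY]] := weyl_sequence_sums p1 dI TE y_loc Ty_small.
pose E n (b : nat -> bool) := exists (x : I -> C) (c : 'I_m -> C),
  [/\ lp_le p x n%:R, forall k, modulus (c k) <= n%:R &
      forall i, T (Y b) i = T x i + \sum_(k < m) c k * v k i].
have Tloc i : exists M, forall b n, (M <= n)%N ->
    T (Y b) i = \sum_(j < n) (b j)%:R * 2 ^+ j * T (y j) i.
  have /choice[M hM] := hY.
  exists (\max_(q <- row i) M q.1) => b n Mn.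
  rewrite -(finrow_lincomb TE); apply: (finrow_local TE) => q qi; apply: hM.
  apply: leq_trans Mn; exact: (@leq_bigmax_seq _ (row i) xpredT (fun q => M q.1)).
have Eall b : exists n, E n b.
  have [z [x xp <-] [c hc]] := codim _ (Ylp b).
  have [K _ xK] := lp_fin xp.
  have K0 := lp_le_ge0 xK.
  have S0 : 0 <= \sum_k modulus (c k) by apply: sumr_ge0 => k _; exact: modulus_ge0.
  pose n := Num.truncn (K + \sum_k modulus (c k)).
  have nlt : K + \sum_k modulus (c k) < n.+1%:R by rewrite truncnS_gt// addr_ge0.
  exists n.+1, x, c; split.
  - by apply: lp_leW xK; rewrite (le_trans _ (ltW nlt))// lerDl.
  - move=> k; rewrite (le_trans _ (ltW nlt))// (bigD1 k)//= addrCA lerDl addr_ge0//.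
    by apply: sumr_ge0 => i _; exact: modulus_ge0.
  - move=> i; rewrite hc fctE; congr (_ + _).
    by rewrite fct_sumE; apply: eq_bigr => k _.
have Ecl n b :
    (forall k, exists b', (forall j, (j < k)%N -> b' j = b j) /\ E n b') -> E n b.
  move=> /choice[bk hbk].
  have /choice[xk /choice[ck hk]] : forall k, exists (x : I -> C) (c : 'I_m -> C),
    [/\ lp_le p x n%:R, forall k, modulus (c k) <= n%:R &
      forall i, T (Y (bk k)) i = T x i + \sum_(k < m) c k * v k i].
    by move=> k; exact: (hbk k).2.
  (* Data bounded by [n] have pointwise limits with the same bounds, and each place of [T (Y b)]
     sees only finitely many entries of [b]; so the equation survives the limit. *)
  have [F [UF sF]] := ultraFilterLemma eventually_filter.
  have xkK k : lp_le p (xk k) n%:R by have [] := hk k.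
  have [x xP] := choice (fun i => ulim_bounded (fun k => lp_le_coord p1 dI i (xkK k))).
  have ckK k l : modulus (ck k l) <= n%:R by have [] := hk k.
  have [c cP] := choice (fun l => ulim_bounded (fun k => ckK k l)).
  exists x, c; split.
  - exact: (lp_le_ulim p1 dI xP xkK).
  - move=> l; apply: (ulim_modulus_le _ (cP l)).
    by apply: (@filterS _ F _ setT) => [k _ /=|]; [exact: ckK|exact: filterT].
  move=> i.
  have h1 : (fun k => T (xk k) i + \sum_(l < m) ck k l * v l i) @ F -->
      T x i + \sum_(l < m) c l * v l i.
    apply: cvgD; first exact: (finrow_cvg TE).
    by apply: cvg_bigsum => l; apply: cvgM; [exact: cP|exact: cvg_cst].
  apply: (@cvg_unique _ (@norm_hausdorff _ C) _ _ _ _ _ h1).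
  apply: (@cvg_trans _ (cst (T (Y b) i) @ F)); last exact: cvg_cst.
  apply: near_eq_cvg; apply: sF; have [M hM] := Tloc i.
  exists M => // k /= Mk; have [_ _ <-] := hk k.
  rewrite !(hM _ M)//; apply: eq_bigr => j _.
  by rewrite (hbk k).1// (leq_trans (ltn_ord j)).
have [n [j0 [b0 hb0]]] := cantor_baire Ecl Eall.
exists n, j0 => j j0j.
(* The entries of [b1] from [j0] on are false, so switching on entry [j] stays in the cylinder and
   adds exactly the term 2^j T y_j. *)
pose b1 l := if (l < j0)%N then b0 l else false.
pose b2 l := if (l == j) then true else b1 l.
have [x1 [c1 [x1n c1n h1]]] : E n b1 by apply: hb0 => l lj0; rewrite /b1 lj0.
have [x2 [c2 [x2n c2n h2]]] : E n b2.
  by apply: hb0 => l lj0; rewrite /b2 /b1 lj0 ltn_eqF// (leq_trans lj0).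
exists (fun i => x2 i - x1 i), (fun k => c2 k - c1 k); split.
  rewrite natrD; apply: (lp_leD p1 dI x2n).
  by apply: (lp_le_mono p1 dI) x1n => i; rewrite modulusN.
move=> i; rewrite (finrowB TE).
have -> : 2 ^+ j * T (y j) i = T (Y b2) i - T (Y b1) i.
  have [M hM] := Tloc i.
  pose n' := maxn M j.+1.
  have jn : (j < n')%N by rewrite leq_max leqnn orbT.
  rewrite !(hM _ n') ?leq_maxl// -sumrB (bigD1 (Ordinal jn))//= big1 => [|k kj].
    by rewrite addr0 /b2 eqxx /b1 ltnNge j0j !mul0r subr0 mul1r.
  rewrite /b2 ifF ?subrr//; apply/negbTE; exact: kj.
rewrite h2 h1 opprD addrACA -sumrB; congr (_ + _).
by apply: eq_bigr => k _; rewrite mulrBl.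
Qed.

(* With [2 ^ j T y_j = T x_j + ...], the vectors [2 ^ j y_j - x_j] are mapped into a
   space of dimension [m], and [ker T] has dimension at most [nk]; so [m + nk + 1] of
   them are dependent, although the [x_j] are too short to cancel the [2 ^ j y_j]. *)
Lemma weyl_sequence_not_fredholm : ~ fredholm_on p T.
Proof.
move=> [[nk [kv [kvX kerP]]] [m [v [vX codim]]]].
have [n [j0 hx]] := weyl_sequence_cylinder codim.
pose N := (m + nk).+1.
(* Large enough that 2^(j1 + l) exceeds 2 N (n + n), so that a sum of N vectors x_j divided by 2^(j1
   + l) has norm at most 1/2. *)
pose j1 := (j0 + (4 * N * (n + n)).+1)%N.
have /choice[x hx'] : forall j : 'I_N, exists x : I -> C, exists c : 'I_m -> C,
    lp_le p x (n + n)%:R /\ forall i, 2 ^+ (j1 + j) * T (y (j1 + j)) i = T x i + \sum_(k < m) c k * v k i.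
  by move=> j; apply: hx; rewrite -addnA leq_addr.
have /choice[c xc] := hx'.
pose g (j : 'I_N) i := 2 ^+ (j1 + j) * y (j1 + j)%N i - x j i.
have xlp j : lp p (x j) by apply/lp_leP; exists (n + n)%:R; have [] := xc j.
have glp j : lp p (g j).
  have [K _ yK] := lp_fin (y_lp (j1 + j)%N); have [K' _ xK] := lp_fin (xlp j).
  apply/lp_leP; exists (modulus ((2 : C) ^+ (j1 + j)) * K + K').
  apply: (lp_leD p1 dI (lp_leZ p1 dI _ yK)).
  by apply: (lp_le_mono p1 dI) xK => i; rewrite modulusN.
have Tg j i : T (g j) i = \sum_(k < m) c j k * v k i.
  by rewrite (finrowB TE) (finrowZ TE) (xc j).2 addrAC subrr add0r.
(* Combinations of the [g j] with coefficients in the left kernel of [D] are annihilated by [T];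
   that kernel has dimension at least nk + 1. *)
pose D : 'M[C]_(N, m) := \matrix_(j, k) c j k.
pose B := row_base (kermx D).
have BD : B *m D = 0.
  by apply/sub_kermxP; rewrite eq_row_base.
pose h (a : 'I_(\rank (kermx D))) i := \sum_j B a j * g j i.
have hlp a : lp p (h a) by exact: (lp_lincomb p1 dI).
have Th a : T (h a) = 0.
  apply/funext => i; rewrite (finrow_lincomb TE) -[RHS]/0.
  under eq_bigr do rewrite Tg mulr_sumr.
  rewrite exchange_big/= big1// => k _.
  have /matrixP/(_ a k) := BD; rewrite mxE [RHS]mxE => BDak.
  under eq_bigr do rewrite mulrA; rewrite -mulr_suml.
  rewrite [X in X * _](_ : _ = \sum_j B a j * D j k); first by rewrite BDak mul0r.
  by apply: eq_bigr => j _; rewrite [D _ _]mxE.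
have /choice[e he] : forall a, exists e : 'I_nk -> C, h a = \sum_(k < nk) e k *: kv k.
  by move=> a; apply: kerP; split => //=.
pose Em : 'M[C]_(\rank (kermx D), nk) := \matrix_(a, k) e a k.
have rk : (nk < \rank (kermx D))%N.
  by rewrite mxrank_ker ltn_subRL /N ltnS leq_add2r rank_leq_col.
have [s s0 sE] := exists_left_kernel Em rk.
pose tau := s *m B.
have tau0 : tau != 0.
  apply: contra_neq s0 => tau0.
  by apply: (row_free_inj (row_base_free (kermx D))); rewrite mul0mx.
have taug i : \sum_j tau 0 j * g j i = 0.
  transitivity (\sum_a s 0 a * h a i).
    rewrite /h; under [RHS]eq_bigr do rewrite mulr_sumr.
    rewrite exchange_big/=; apply: eq_bigr => j _.
    by rewrite mxE mulr_suml; apply: eq_bigr => a _; rewrite mulrA.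
  transitivity (\sum_a \sum_k s 0 a * e a k * kv k i).
    apply: eq_bigr => a _; rewrite he fct_sumE mulr_sumr; apply: eq_bigr => k _.
    by rewrite mulrA.
  rewrite exchange_big/= big1// => k _; rewrite -mulr_suml.
  have /matrixP/(_ 0 k) := sE; rewrite mxE [RHS]mxE => h0.
  rewrite [X in X * _](_ : _ = \sum_a s 0 a * Em a k); first by rewrite h0 mul0r.
  by apply: eq_bigr => j _; rewrite [Em _ _]mxE.
(* Dividing by the largest coefficient makes all quotients at most 1 in modulus. *)
have [l _ lmax] := @arg_maxP _ _ _ (ord0 : 'I_N) xpredT (fun j => modulus (tau 0 j)) isT.
have tl : 0 < modulus (tau 0 l).
  rewrite lt_def modulus_ge0 andbT; apply: contra_neq tau0 => tl0.
  apply/rowP => j; rewrite [RHS]mxE; apply/eqP.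
  rewrite -modulus_eq0 eq_le modulus_ge0 andbT.
  by rewrite -tl0; exact: lmax.
(* Supports are disjoint: where y_(j1+l) is nonzero the other y_j vanish, and the relation expresses
   it through the x_j alone. *)
have yl i : modulus (y (j1 + l)%N i) <=
    modulus (2^-1 ^+ (j1 + l) * \sum_j (tau 0 j / tau 0 l) * x j i).
  have [->|yi] := eqVneq (y (j1 + l)%N i) 0; first by rewrite modulus0 modulus_ge0.
  rewrite [X in modulus X <= _]
    (_ : _ = 2^-1 ^+ (j1 + l) * \sum_j (tau 0 j / tau 0 l) * x j i)//.
  have := taug i; rewrite /g; under eq_bigr do rewrite mulrBr.
  rewrite sumrB => /eqP; rewrite subr_eq0 (bigD1 l)//= big1 ?addr0 => [/eqP e1|k kl].
    have tl0 : tau 0 l != 0 by rewrite -modulus_eq0 gt_eqF.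
    have -> : \sum_j tau 0 j / tau 0 l * x j i = (tau 0 l)^-1 * \sum_j tau 0 j * x j i.
      by rewrite mulr_sumr; apply: eq_bigr => k _; rewrite mulrAC mulrC.
    rewrite -e1 mulKf// mulrA -exprMn mulVf ?expr1n ?mul1r//.
  rewrite (_ : y (j1 + k)%N i = 0) ?mulr0//; apply/eqP; apply: contraNT kl => yk.
  by have /addnI/val_inj -> := y_disj yk yi.
have S : lp_le p (fun i => \sum_j (tau 0 j / tau 0 l) * x j i) (\sum_(j < N) (n + n)%:R).
  apply: (lp_le_bigsum p1 dI) => j.
  have [xj _] := xc j; have := lp_leZ p1 dI (tau 0 j / tau 0 l) xj.
  apply: lp_leW; rewrite ler_piMl ?ler0n// modulusM modulusV ler_pdivrMr// mul1r.
  exact: lmax.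
apply: (@y_big (j1 + l)%N); apply: lp_leW; last first.
  apply: (lp_le_mono p1 dI yl); exact: (lp_leZ p1 dI _ S).
have -> : (2^-1 : C) ^+ (j1 + l) = toC (2^-1 ^+ (j1 + l)).
  by rewrite /toC rmorphXn/= fmorphV rmorph_nat.
rewrite modulus_toC ger0_norm ?exprn_ge0 ?invr_ge0//.
rewrite sumr_const card_ord -mulrnA exprVn ler_pdivrMl ?exprn_gt0//.
rewrite ler_pdivlMr// -natrX -!natrM ler_nat.
have : (j1 + l < 2 ^ (j1 + l))%N by exact: ltn_expl.
rewrite /j1; nia.
Qed.

End Sequence.
End NotFredholm.

Section WeylCriterion.
Variables (R : realType) (p : \bar R) (p1 : (1 <= p)%E).
Local Notation C := (Cplx R).

(** Disjoint supports are obtained by recursion: [st j] lists the places occupied so far, and the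
    next vector avoids them with tolerance 4^-j. *)
Lemma weyl_not_fredholm (d : measure_display) (I : measurableType d) (dI : discrete I)
    (T : (I -> C) -> (I -> C)) (row : I -> seq (I * C)) :
  (forall x i, T x i = \sum_(q <- row i) q.2 * x q.1) ->
  (forall (e : R) (s : seq I), 0 < e -> exists (y : I -> C) (t : seq I),
    [/\ forall i, y i != 0 -> i \in t /\ i \notin s,
        ~ lp_le p y 2^-1 & lp_le p (T y) e]) ->
  ~ fredholm_on p T.
Proof.
move=> TE hT.
have /choice[f fP] : forall js : nat * seq I, exists yt : (I -> C) * seq I,
    [/\ forall i, yt.1 i != 0 -> i \in yt.2 /\ i \notin js.2,
        ~ lp_le p yt.1 2^-1 & lp_le p (T yt.1) (4^-1 ^+ js.1)].
  move=> [j s]; have [|y [t [? ? ?]]] := hT (4^-1 ^+ j) s.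
    by rewrite exprn_gt0 ?invr_gt0.
  by exists (y, t).
pose st := fix st j := if j is j'.+1 then st j' ++ (f (j', st j')).2 else [::].
pose y j := (f (j, st j)).1.
have st_mono j k i : (j <= k)%N -> i \in st j -> i \in st k.
  move=> /subnKC <- ij; elim: (k - j)%N => [|m IH]; first by rewrite addn0.
  by rewrite addnS /= mem_cat IH.
have ylt j k i : (j < k)%N -> y j i != 0 -> y k i = 0.
  move=> jk yj; apply/eqP; apply/negPn/negP => yk.
  have [/(_ i yj)[h1 _] _ _] := fP (j, st j).
  have [/(_ i yk)[_ /negP h2] _ _] := fP (k, st k).
  by apply: h2; apply: (st_mono j.+1) => //=; rewrite mem_cat h1 orbT.
apply: (weyl_sequence_not_fredholm p1 dI TE (y := y)).
- move=> j k i yj yk; have [jk|kj|//] := ltngtP j k.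
    by move: yk; rewrite (ylt _ _ _ jk yj) eqxx.
  by move: yj; rewrite (ylt _ _ _ kj yk) eqxx.
- move=> i; have [[j yj]|no] := pselect (exists j, y j i != 0).
    by exists j.+1 => k jk; exact: ylt yj.
  by exists 0%N => j _; apply/eqP; apply/negPn/negP => yj; apply: no; exists j.
- by move=> j; have [] := fP (j, st j).
- move=> j; have [h _ _] := fP (j, st j).
  apply/lp_leP; exists (\sum_(i <- (f (j, st j)).2) modulus (y j i)).
  apply: (lp_le_mono p1 dI _ (lp_le_restrict p1 dI _ _)) => i.
  have [->|/h[-> _]//] := eqVneq (y j i) 0; by rewrite if_same.
- by move=> j; have [] := fP (j, st j).
Qed.

End WeylCriterion.

(** * From bounded kernel vectors to approximate kernel vectors in l^p *)

Section ApproximateKernel.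
Variables (R : realType) (p : \bar R) (p1 : (1 <= p)%E).
Local Notation C := (Cplx R).
Variables U V W : set C.
Hypotheses (cU : compact U) (cV : compact V) (cW : compact W).

(** With r = 1/(1 + h), the weights r^|k| change by a relative amount of at most [h] from one place
    to the next, in either direction. *)
Lemma geometric_diff_le (r h : R) (a b : nat) : 0 <= r -> 0 <= h -> r * (1 + h) = 1 ->
  a = b.+1 \/ b = a.+1 -> `|r ^+ a - r ^+ b| <= h * r ^+ a.
Proof.
move=> r0 h0 rh; have r1 : r <= 1 by nra.
case=> ->; rewrite exprS.
  have p0 := exprn_ge0 b r0; set q := r ^+ b in p0 *.
  have -> : r * q - q = - (h * (r * q)).
    have -> : h * (r * q) = (r * (1 + h)) * q - r * q by ring.
    by rewrite rh; ring.
  by rewrite normrN ger0_norm// !mulr_ge0.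
have p0 := exprn_ge0 a r0; set q := r ^+ a in p0 *.
have -> : q - r * q = r * h * q.
  have -> : r * h * q = (r * (1 + h)) * q - r * q by ring.
  by rewrite rh; ring.
by rewrite ger0_norm ?mulr_ge0// ler_wpM2r// ler_piMl.
Qed.

(** Inside the window the weights cause an error of relative size [h]; at the cut the vector is
    already of size r^n. Both are compared with the norm of the weighted vector, by which it is
    finally divided. *)
Lemma jac_approx_kernel u0 v0 w0 x0 X i0 : jac_in U V W u0 v0 w0 ->
  bounded_by x0 X -> (forall k, jac u0 v0 w0 x0 k = 0) -> x0 i0 != 0 ->
  forall e : R, 0 < e -> exists u v w y n,
    [/\ jac_in U V W u v w, forall k : int, (n < absz k)%N -> y k = 0,
        lp_le p y 1, ~ lp_le p y 2^-1 & lp_le p (jac u v w y) e].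
Proof.
move=> in0 x0X jx0 x0i e e0.
pose u k := u0 (i0 + k); pose v k := v0 (i0 + k); pose w k := w0 (i0 + k).
pose x k := (x0 i0)^-1 * x0 (i0 + k).
have inM : jac_in U V W u v w by move=> k; exact: in0.
have jx k : jac u v w x k = 0 by rewrite jacZ jac_shift jx0 mulr0.
have {X x0X} [X xX] : exists X, bounded_by x X.
  exists ((modulus (x0 i0))^-1 * X).
  by move=> k; rewrite modulusM modulusV ler_wpM2l ?invr_ge0 ?modulus_ge0.
have x1 : x 0 = 1 by rewrite /x addr0 mulVf.
clearbody u v w x; clear in0 jx0 x0i x0 u0 v0 w0 i0.
have X1 : 1 <= X by rewrite -(@modulus1 R) -x1.
have [a a0 Ua] := compact_modulus_le cU.
have [b b0 Wb] := compact_modulus_le cW.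
have [c c0 hc] := jac_modulus_le cU cV cW.
(* A positive constant above all coefficient bounds; [h] is chosen so that c' h times 3 K, the error
   inside, is K e / 2. *)
pose c' := c + a + b + 1.
pose h := e / (6 * c').
have c'0 : 0 < c' by rewrite /c'; lra.
have h0 : 0 < h by rewrite divr_gt0// mulr_gt0.
pose r := (1 + h)^-1.
have hE : h = e / (6 * c') by [].
have r0 : 0 < r by rewrite invr_gt0; lra.
have rge0 := ltW r0; have hge0 := ltW h0; have cge0 := ltW c'0.
have rh : r * (1 + h) = 1 by rewrite mulVf// gt_eqF//; lra.
have r1 : r < 1 by rewrite invf_lt1; lra.
clearbody h r.
(* Each of the four places at the cut then contributes at most 3 c' e / (24 c') = e / 8, together e
   / 2. *)
have [n hn] : exists n : nat, r ^+ n <= e / (24 * (c' * X)).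
  have : (fun m => r ^+ m) @ \oo --> (0 : R).
    by apply: cvg_expr; rewrite gtr0_norm.
  move=> /cvgrPdist_lt/(_ (e / (24 * (c' * X)))).
  rewrite divr_gt0 ?mulr_gt0//; last lra.
  move=> /(_ isT)[n _ /(_ n (leqnn _))] /=.
  by rewrite sub0r normrN ger0_norm ?exprn_ge0// => /ltW hn; exists n.
pose y (k : int) := if (absz k <= n.+1)%N then toC (r ^+ absz k) * x k else 0.
have yin k : (absz k <= n.+1)%N -> y k = toC (r ^+ absz k) * x k by rewrite /y => ->.
have yout k : (n.+1 < absz k)%N -> y k = 0 by rewrite /y ltnNge => /negPf ->.
clearbody y.
have my k : modulus (y k) <= r ^+ absz k * X.
  have [kn|/yout->] := leqP (absz k) n.+1; last first.
    by rewrite modulus0 mulr_ge0 ?exprn_ge0//; lra.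
  by rewrite yin// modulusM modulus_toC ger0_norm ?exprn_ge0// ler_wpM2l ?exprn_ge0.
pose z1 (k : int) := if (absz k <= n)%N then jac u v w y k else 0.
(* The places at which the cut after n + 1 is felt; beyond them the image vanishes. *)
pose s : seq int := [:: n.+1%:Z; - n.+1%:Z; n.+2%:Z; - n.+2%:Z].
have z1P k : modulus (z1 k) <=
    c' * h * (modulus (y (k - 1)) + modulus (y k) + modulus (y (k + 1))).
  rewrite /z1; case: ifP => kn; last first.
    rewrite modulus0; apply: mulr_ge0; first exact: mulr_ge0.
    by apply: addr_ge0; [apply: addr_ge0|]; exact: modulus_ge0.
  (* Subtracting r^|k| times the vanishing image of [x] cancels the main diagonal and leaves
     differences of weights. *)
  have -> : jac u v w y k = u k * toC (r ^+ absz (k - 1) - r ^+ absz k) * x (k - 1)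
      + w k * toC (r ^+ absz (k + 1) - r ^+ absz k) * x (k + 1).
    rewrite -[LHS]subr0 -[X in _ - X](mulr0 (toC (r ^+ absz k))) -(jx k) /jac.
    have k1 : (absz (k - 1)%R <= n.+1)%N by move: kn; clear; lia.
    have k2 : (absz k <= n.+1)%N by move: kn; clear; lia.
    have k3 : (absz (k + 1)%R <= n.+1)%N by move: kn; clear; lia.
    rewrite (yin _ k1).
    rewrite (yin _ k2).
    rewrite (yin _ k3).
    have sub s' t : toC (s' - t) = toC s' - toC t :> C by rewrite /toC rmorphB.
    by rewrite !sub; ring.
  have yE j : (absz j <= n.+1)%N -> modulus (y j) = r ^+ absz j * modulus (x j).
    by move=> jn; rewrite yin// modulusM modulus_toC ger0_norm ?exprn_ge0.
  have [/Ua hu _ /Wb hw] := inM k.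
  have q1 : modulus (u k * toC (r ^+ absz (k - 1) - r ^+ absz k) * x (k - 1)) <=
      c' * h * modulus (y (k - 1)).
    rewrite yE; last by move: kn; clear; lia.
    rewrite !modulusM modulus_toC mulrA ler_wpM2r ?modulus_ge0//.
    rewrite -mulrA ler_pM ?modulus_ge0//; first by rewrite /c'; lra.
    by apply: geometric_diff_le => //; clear; lia.
  have q2 : modulus (w k * toC (r ^+ absz (k + 1) - r ^+ absz k) * x (k + 1)) <=
      c' * h * modulus (y (k + 1)).
    rewrite yE; last by move: kn; clear; lia.
    rewrite !modulusM modulus_toC mulrA ler_wpM2r ?modulus_ge0//.
    rewrite -mulrA ler_pM ?modulus_ge0//; first by rewrite /c'; lra.
    by apply: geometric_diff_le => //; clear; lia.
  apply: (le_trans (modulusD _ _)); rewrite !mulrDr.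
  have := mulr_ge0 (mulr_ge0 cge0 hge0) (modulus_ge0 (y k)).
  by move: q1 q2; lra.
have edge (k : int) : k \in s -> modulus (jac u v w y k) <= c' * (3 * (e / (24 * c'))).
  move=> ks; apply: (le_trans (hc _ _ _ _ _ inM)).
  have yle j : (n <= absz j)%N -> modulus (y j) <= e / (24 * c').
    move=> nj; apply: (le_trans (my j)).
    have : r ^+ absz j <= r ^+ n by rewrite ler_wiXn2l// ltW.
    move=> rj; apply: (@le_trans _ _ (e / (24 * (c' * X)) * X)).
      by rewrite ler_wpM2r ?(le_trans rj)//; lra.
    rewrite le_eqVlt; apply/orP; left; apply/eqP; field.
    by apply/andP; split; apply: lt0r_neq0 => //; lra.
  have k3 : [/\ (n <= absz (k - 1)%R)%N, (n <= absz k)%N & (n <= absz (k + 1)%R)%N].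
    by move: ks; clear; rewrite !inE => /or4P[]/eqP->; split; lia.
  have [/yle g1 /yle g2 /yle g3] := k3.
  apply: ler_pM => //; first by rewrite !addr_ge0 ?modulus_ge0.
    by rewrite /c'; lra.
  lra.
have jyE (k : int) : jac u v w y k = z1 k + (if k \in s then jac u v w y k else 0).
  rewrite /z1; case: ifPn => kn.
    rewrite ifF ?addr0//; apply/negbTE/negP; move: kn; clear.
    by rewrite !inE => kn /or4P[]/eqP h1; rewrite h1 in kn; lia.
  case: ifPn => ks; first by rewrite add0r.
  have [k1 k2 k3] : [/\ (n.+1 < absz (k - 1)%R)%N, (n.+1 < absz k)%N
      & (n.+1 < absz (k + 1)%R)%N].
    move: kn ks; clear; rewrite !inE !negb_or => kn.
    by move=> /and4P[/eqP ? /eqP ? /eqP ? /eqP ?]; split; lia.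
  by rewrite addr0 /jac (yout _ k1) (yout _ k2) (yout _ k3) !mulr0 !addr0.
have [K yK yKle] : exists2 K, lp_norm p y = K%:E & lp_le p y K.
  apply: lp_fin; apply/lp_leP.
  pose t := [seq i%:Z | i <- iota 0 n.+2] ++ [seq - i%:Z | i <- iota 0 n.+2].
  exists (\sum_(i <- t) modulus (y i)).
  apply: (lp_le_mono p1 discrete_int _ (lp_le_restrict p1 discrete_int _ _)) => i.
  case: ifPn => // it; rewrite (yout i) ?modulus0// ltnNge; apply: contraNN it => ik.
  rewrite mem_cat; have [i0|i0] := leP 0 i; apply/orP; [left|right]; apply/mapP.
    by exists (absz i); move: ik i0; clear; rewrite ?mem_iota; lia.
  by exists (absz i); move: ik i0; clear; rewrite ?mem_iota; lia.
(* The entry at 0 is 1; so the error e / 2 at the cut is also at most K e / 2. *)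
have K1 : 1 <= K.
  by have := lp_le_coord p1 discrete_int 0 yKle; rewrite yin//= expr0 mul1r x1 modulus1.
have jyK : lp_le p (jac u v w y) (c' * h * (3 * K) + \sum_(k <- s) modulus (jac u v w y k)).
  have g1 : lp_le p z1 (c' * h * (3 * K)).
    by apply: (lp_le_neighbours p1 _ z1P yKle); rewrite mulr_ge0.
  have g2 := lp_leD p1 discrete_int g1 (lp_le_restrict p1 discrete_int s (jac u v w y)).
  apply: (lp_le_mono p1 discrete_int _ g2) => k.
  by rewrite jyE.
have Kinv : modulus (toC K^-1) = K^-1 by rewrite modulus_toC ger0_norm// invr_ge0; lra.
exists u, v, w, (fun k => toC K^-1 * y k), n.+1; split => //.
- by move=> k kn; rewrite yout ?mulr0.
- by have := lp_leZ p1 discrete_int (toC K^-1) yKle; rewrite Kinv mulVf//; lra.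
- move=> yhalf; have := lp_leZ p1 discrete_int (toC K) yhalf.
  move=> /(lp_le_mono p1 discrete_int (x := y)) h2.
  have : lp_le p y (modulus (toC K) * 2^-1).
    by apply: h2 => k; rewrite mulrA -toCM divff ?mul1r//; lra.
  by rewrite /lp_le yK lee_fin modulus_toC ger0_norm; lra.
- have := lp_leZ p1 discrete_int (toC K^-1) jyK; rewrite Kinv => h2.
  have : lp_le p (jac u v w (fun k => toC K^-1 * y k))
      (K^-1 * (c' * h * (3 * K) + \sum_(k <- s) modulus (jac u v w y k))).
    by apply: (lp_le_mono p1 discrete_int _ h2) => k; rewrite jacZ.
  apply: lp_leW.
  have : \sum_(k <- s) modulus (jac u v w y k) <= e / 2.
    rewrite !big_cons big_nil.
    have := edge n.+1%:Z; have := edge (- n.+1%:Z).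
    have := edge n.+2%:Z; have := edge (- n.+2%:Z).
    rewrite !inE !eqxx !orbT => /(_ isT) + /(_ isT) + /(_ isT) + /(_ isT).
    have -> : c' * (3 * (e / (24 * c'))) = e / 8 by field; lra.
    lra.
  have -> : c' * h * (3 * K) = K * (e / 2) by rewrite hE; field; lra.
  move=> hs; rewrite ler_pdivrMl; last lra.
  nra.
Qed.

End ApproximateKernel.

(** * Pseudoergodic matrices *)

Section Pseudoergodic.
Variables (R : realType).
Local Notation C := (Cplx R).

Lemma dist3_lt (a b : C * C * C) (e : R) : dist3 a b < e ->
  [/\ modulus (a.1.1 - b.1.1) < e, modulus (a.1.2 - b.1.2) < e & modulus (a.2 - b.2) < e].
Proof.
rewrite /dist3.
set s := (X in Num.sqrt X).
have h (m : R) : 0 <= m -> m ^+ 2 <= s -> Num.sqrt s < e -> m < e.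
  by move=> m0 ms; apply: le_lt_trans; rewrite -(ger0_norm m0) -sqrtr_sqr ler_wsqrtr.
have := sqr_ge0 (modulus (a.1.1 - b.1.1)); have := sqr_ge0 (modulus (a.1.2 - b.1.2)).
have := sqr_ge0 (modulus (a.2 - b.2)) => s3 s2 s1 se.
by split; apply: h se; rewrite ?modulus_ge0// /s; lra.
Qed.

Variables U V W : set C.

Lemma pseudoergodic_window (J : set int) A (u v w : int -> C) (e : R) (n : nat)
    (s : seq int) :
  pseudoergodic (@dist3 R) (U `*` V `*` W) J (diagonals A) ->
  (forall k, [/\ U (u k), V (v k) & W (w k)]) -> 0 < e ->
  exists c : int, forall j : int, (absz j <= n)%N ->
    [/\ J (c + j), c + j \notin s, modulus (subdiag A (c + j) - u j) < e,
        modulus (maindiag A (c + j) - v j) < e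
      & modulus (superdiag A (c + j) - w j) < e].
Proof.
move=> pA inM e0.
pose m := \max_(i <- s) absz i.
have ms i : i \in s -> (absz i <= m)%N.
  by move=> si; exact: (@leq_bigmax_seq _ s xpredT absz).
pose L := (n + n).+1.
(* Two copies of the pattern so far apart that one of them avoids [s]. *)
pose pat (i : nat) : int := if (i <= L)%N then i%:Z - n.+1%:Z
  else i%:Z - n.+1%:Z - (L + m + m).+1%:Z.
have [||k [_ hk]] := pA e (L + (L + m + m).+1)%N
  (fun i => (u (pat i), v (pat i), w (pat i))) e0 => //.
  by move=> i _; have [] := inM (pat i).
have key (c : int) : (forall j : int, (absz j <= n)%N -> exists i : nat,
    [/\ (0 < i <= L + (L + m + m).+1)%N, k + i%:Z = c + j & pat i = j]) ->
    (forall j : int, (absz j <= n)%N -> (m < absz (c + j)%R)%N) ->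
  exists c : int, forall j : int, (absz j <= n)%N ->
    [/\ J (c + j), c + j \notin s, modulus (subdiag A (c + j) - u j) < e,
        modulus (maindiag A (c + j) - v j) < e
      & modulus (superdiag A (c + j) - w j) < e].
  move=> h1 h2; exists c => j jn; have [i [iL kc ij]] := h1 j jn.
  have [Ji /dist3_lt /=] := hk i iL; rewrite kc ij in Ji * => -[? ? ?]; split => //.
  by apply/negP => /ms; rewrite leqNgt h2.
(* If some point of the first copy lies within [m] of 0, the offset of L + 2m + 1 puts every point
   of the second copy beyond [m]. *)
have [h|h] := pselect (forall j : int, (absz j <= n)%N -> (m < absz (k + n.+1%:Z + j)%R)%N).
  apply: (key (k + n.+1%:Z)) => // j jn; exists (absz (j + n.+1%:Z)).
  have e1 : (absz (j + n.+1%:Z) : int) = j + n.+1%:Z by move: jn; clear; lia.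
  have e2 : (0 < absz (j + n.+1%:Z)%R <= L)%N by move: jn; rewrite /L; clear; lia.
  rewrite /pat e1; move: e2 => /andP[e2 e3]; rewrite e2 e3; split => //.
  - by rewrite (leq_trans e3)// leq_addr.
  - by clear; lia.
  - by clear; lia.
have [j0 j0n j0m] : exists2 j0 : int, (absz j0 <= n)%N & (absz (k + n.+1%:Z + j0)%R <= m)%N.
  apply: contrapT => no; apply: h => j jn; rewrite ltnNge; apply/negP => jm.
  by apply: no; exists j.
apply: (key (k + n.+1%:Z + (L + m + m).+1%:Z)) => j jn; last first.
  by move: j0n j0m jn; rewrite /L; clear; lia.
exists (absz (j + n.+1%:Z + (L + m + m).+1%:Z)).
have e1 : (absz (j + n.+1%:Z + (L + m + m).+1%:Z) : int) = j + n.+1%:Z + (L + m + m).+1%:Z.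
  by move: jn; clear; lia.
rewrite /pat e1; split.
- by move: jn; rewrite /L; clear; lia.
- by clear; lia.
- by rewrite ifF; move: jn; rewrite /L; clear; lia.
Qed.

Hypotheses (cU : compact U) (cV : compact V) (cW : compact W).
Variables (p : \bar R) (p1 : (1 <= p)%E).

(** The vector is moved to a place where [A] nearly repeats its coefficients. It has norm at most 1,
    so errors e/6 on three diagonals cost e/2, the other half being its own defect. *)
Lemma psi_approx_kernel (J : set int) A lam : PsiE_on U V W J A ->
  ~ jac_injective U (shifted_set V lam) W ->
  forall (e : R) (s : seq int), 0 < e -> exists (y : int -> C) (t : seq int),
    [/\ forall i, y i != 0 -> [/\ J i, i \in t & i \notin s],
        ~ lp_le p y 2^-1 &
        lp_le p (jac (subdiag A) (fun k => maindiag A k - lam) (superdiag A) y) e].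
Proof.
move=> [AM pA] ninj e s e0.
have [u0 [v0 [w0 [x0 [X [in0 x0X jx0 [i0 /eqP x0i]]]]]]] : exists u v w x X,
    [/\ jac_in U (shifted_set V lam) W u v w, bounded_by x X,
        forall k, jac u v w x k = 0 & exists k, x k <> 0].
  apply: contrapT => no; apply: ninj => u v w x X inM xX jx k.
  by apply: contrapT => xk; apply: no; exists u, v, w, x, X; split => //; exists k.
have e2 : 0 < e / 2 by rewrite divr_gt0.
have [u [v [w [y [n [inM yn y1 ybig yjac]]]]]] :=
  jac_approx_kernel p1 cU (compact_shifted (lam := lam) cV) cW in0 x0X jx0 x0i e2.
have e6 : 0 < e / 6 by rewrite divr_gt0.
have inM' k : [/\ U (u k), V (v k + lam) & W (w k)].
  by have [? [z Vz <-] ?] := inM k; rewrite subrK.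
(* One more than the support radius [n], since the rows adjacent to the support also see it. *)
have [c hc] := pseudoergodic_window n.+1 s pA inM' e6.
pose y' (i : int) := y (i - c).
have y'P i : y' i != 0 -> (absz (i - c)%R <= n)%N.
  by rewrite /y' leqNgt => yi; apply/negP => /yn yi0; rewrite yi0 eqxx in yi.
have y'le (K : R) : lp_le p y K <-> lp_le p y' K.
  split; first exact: lp_le_shift.
  move=> /(lp_le_shift p1 c); apply: (lp_le_mono p1 discrete_int) => i.
  by rewrite /y' addrK.
have hc' i : (absz (i - c)%R <= n.+1)%N ->
    [/\ J i, i \notin s, modulus (subdiag A i - u (i - c)) <= e / 6,
        modulus (maindiag A i - lam - v (i - c)) <= e / 6
      & modulus (superdiag A i - w (i - c)) <= e / 6].
  move=> /hc; rewrite addrCA subrr addr0 => -[? ? /ltW ? /ltW h /ltW ?]; split => //.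
  by rewrite -addrA -opprD (addrC lam).
pose Ay := jac (subdiag A) (fun k => maindiag A k - lam) (superdiag A) y'.
have zle k : modulus (Ay k - jac u v w y (k - c)) <=
    e / 6 * (modulus (y' (k - 1)) + modulus (y' k) + modulus (y' (k + 1))).
  have [kc|kc] := leqP (absz (k - c)%R) n.+1; last first.
    have y0 i : (n < absz (i - c)%R)%N -> y' i = 0 by exact: yn.
    have -> : Ay k = 0.
      by rewrite /Ay /jac !y0 ?mulr0 ?addr0//; move: kc; clear; lia.
    have -> : jac u v w y (k - c) = 0.
      by rewrite /jac !yn ?mulr0 ?addr0//; move: kc; clear; lia.
    rewrite subr0 modulus0; apply: mulr_ge0; first exact: ltW.
    by apply: addr_ge0; [apply: addr_ge0|]; exact: modulus_ge0.
  have [_ _ h1 h2 h3] := hc' k kc.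
  have -> : Ay k - jac u v w y (k - c) = (subdiag A k - u (k - c)) * y' (k - 1)
      + (maindiag A k - lam - v (k - c)) * y' k + (superdiag A k - w (k - c)) * y' (k + 1).
    rewrite /Ay /jac /y' (addrAC k 1) (addrAC k (-1)); ring.
  rewrite !mulrDr; apply: (le_trans (modulusD _ _)); apply: lerD.
    apply: (le_trans (modulusD _ _)).
    by apply: lerD; rewrite modulusM ler_wpM2r ?modulus_ge0.
  by rewrite modulusM ler_wpM2r ?modulus_ge0.
exists y', ([seq c + i%:Z | i <- iota 0 n.+1] ++ [seq c - i%:Z | i <- iota 0 n.+1]); split.
- move=> i /y'P ic; have [Ji si _ _ _] := hc' i (leqW ic); split => //.
  rewrite mem_cat; apply/orP; have [i0c|i0c] := leP 0 (i - c); [left|right].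
    apply/mapP; exists (absz (i - c)%R); first by rewrite mem_iota; move: ic; clear; lia.
    by move: i0c; clear; lia.
  apply/mapP; exists (absz (i - c)%R); first by rewrite mem_iota; move: ic; clear; lia.
  by move: i0c; clear; lia.
- by move=> /y'le.
- have h1 := lp_le_neighbours p1 (ltW e6) zle ((y'le 1).1 y1).
  have h2 := lp_le_shift p1 (- c) yjac.
  have h3 := lp_leD p1 discrete_int h2 h1.
  have {h3} : lp_le p Ay (e / 2 + e / 6 * (3 * 1)).
    by apply: (lp_le_mono p1 discrete_int _ h3) => k /=; rewrite addrC subrK.
  by apply: lp_leW; lra.
Qed.

End Pseudoergodic.

(** * Semi-infinite matrices *)

Section SemiInfinite.
Variables (R : realType).
Local Notation C := (Cplx R).

Definition extend_by0 (x : nat -> C) (k : int) : C := if k is Posz n then x n else 0.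

Definition extend_diag (c : C) (f : nat -> C) (k : int) : C :=
  if k is Posz n then f n else c.

(** The value [u 0] is free because it meets the entry 0 at place -1; it can thus be taken in U or
    as 0. *)
Lemma shifted_op_plus (U V W : set C) B lam x n (u : nat -> C) : M_plus U V W B ->
  (forall m, u m.+1 = B m.+1 m) ->
  shifted_op B lam x n =
    u n * extend_by0 x (n%:Z - 1) + (B n n - lam) * x n + B n n.+1 * x n.+1.
Proof.
move=> BM uE; rewrite /shifted_op fctE.
rewrite (_ : (- (lam *: x)) n = - (lam * x n))//.
case: n => [|m].
  rewrite (@mulmv_seq _ _ nat B x 0 [:: 0; 1])//.
    by rewrite !big_cons big_nil /= mulr0; ring.
  move=> j; rewrite !inE => j01; have [_ _ _] := BM 0 j; apply.
  by case: j j01 => [|[|j]].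
rewrite (@mulmv_seq _ _ nat B x m.+1 [:: m; m.+1; m.+2]).
- rewrite (_ : m.+1%:Z - 1 = m%:Z) /=; last by lia.
  by rewrite !big_cons big_nil uE; ring.
- by rewrite /= !inE; apply/and3P; split => //; lia.
- move=> j; rewrite !inE => jm; have [_ _ _] := BM m.+1 j; apply.
  by move: jm; lia.
Qed.

Lemma finite_rows_plus (U V W : set C) B : M_plus U V W B ->
  forall n, exists s : seq nat, uniq s /\ forall j, j \notin s -> B n j = 0.
Proof.
move=> BM n; exists (iota 0 n.+2); split; first exact: iota_uniq.
move=> j; rewrite mem_iota => jn; have [_ _ _] := BM n j; apply.
by move: jn; lia.
Qed.

Lemma finite_rows_bi (U V W : set C) A : M_bi U V W A ->
  forall n, exists s : seq int, uniq s /\ forall j, j \notin s -> A n j = 0.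
Proof.
move=> AM n; exists [:: n - 1; n; n + 1]; split.
  by rewrite /= !inE; apply/and3P; split => //; lia.
move=> j; rewrite !inE => jn; have [_ _ _] := AM n j; apply => /=.
by move: jn; rewrite !negb_or => /and3P[/eqP ? /eqP ? /eqP ?]; lia.
Qed.

Variables (p : \bar R) (p1 : (1 <= p)%E).

Lemma lp_le_extend_by0 x K : lp_le p x K -> lp_le p (extend_by0 x) K.
Proof.
apply: (@lp_le_dominated R p p1 _ int _ nat absz _ _ _ discrete_int discrete_nat).
  by move=> [i|i] [j|j] //=; rewrite !inE ?eqxx// => _ _ ->.
by case=> [n|n] //=; rewrite modulus0 modulus_ge0.
Qed.

Lemma lp_le_restrict_nat (x : int -> C) (h : nat -> int) K : injective h ->
  lp_le p x K -> lp_le p (fun n => x (h n)) K.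
Proof.
move=> hinj.
apply: (@lp_le_dominated R p p1 _ nat _ int h _ _ _ discrete_nat discrete_int) => //.
by move=> i j _ _ /hinj.
Qed.

Lemma lp_extend_by0 x : lp p x -> lp p (extend_by0 x).
Proof. by move=> /lp_leP[K xK]; apply/lp_leP; exists K; exact: lp_le_extend_by0. Qed.

Lemma lp_restrict_nat (x : int -> C) (h : nat -> int) : injective h ->
  lp p x -> lp p (fun n => x (h n)).
Proof.
by move=> hi /lp_leP[K xK]; apply/lp_leP; exists K; exact: lp_le_restrict_nat.
Qed.

Variables U V W : set C.
Hypotheses (cU : compact U) (cV : compact V) (cW : compact W).

Lemma invertible_bi A lam : jac_injective U (shifted_set V lam) W -> M_bi U V W A ->
  invertible_on p (shifted_op A lam).
Proof.
move=> inj AM; rewrite (shifted_op_jac lam AM).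
have inM := M_bi_jac_in lam AM.
exact: (jac_invertible p1 cU (compact_shifted cV) cW inj inM).
Qed.

Lemma spec_pt_bigcup lam : (\bigcup_(B in M_bi U V W) spec_pt_infty B) lam <->
  ~ jac_injective U (shifted_set V lam) W.
Proof.
split=> [[B BM ninj] inj|].
  apply: ninj => x x'; rewrite !inE => xp x'p; rewrite (shifted_op_jac lam BM) => xx'.
  have p1' : (1 <= +oo :> \bar R)%E by rewrite leey.
  have [K _ xK] := lp_fin xp; have [K' _ x'K] := lp_fin x'p.
  apply/funext => k; apply/eqP; rewrite -subr_eq0; apply/eqP.
  apply: (inj _ _ _ (fun k => x k - x' k) (K + K') (M_bi_jac_in lam BM)).
    move=> j; apply: (le_trans (modulusB _ _)); apply: lerD.
      exact: (bounded_by_lp p1' discrete_int xK).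
    exact: (bounded_by_lp p1' discrete_int x'K).
  by move=> j; rewrite jacB xx' subrr.
move=> ninj; apply: contrapT => no; apply: ninj => u v w x K inM xK jx k.
apply: contrapT => xk; apply: no.
pose B := bi_matrix u (fun k => v k + lam) w.
have BM : M_bi U V W B.
  apply: M_bi_matrix => j; have [? [z Vz <-] ?] := inM j; split => //.
  by rewrite subrK.
exists B => //= inj; apply: xk.
have p1' : (1 <= +oo :> \bar R)%E by rewrite leey.
have xlp : lp +oo%E x.
  have K0 : 0 <= K by apply: le_trans (xK 0); exact: modulus_ge0.
  by apply/lp_leP; exists K; apply/(lp_norm_ooP discrete_int _ K0).
have lp0 : lp +oo%E (0 : int -> C).
  by apply/lp_leP; exists 0; exact: (lp_le0 p1' discrete_int).
have : x = 0.
  apply: inj; rewrite ?inE//; rewrite (shifted_op_jac lam BM).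
  have [-> -> ->] := bi_matrixE u (fun k => v k + lam) w.
  apply/funext => j; rewrite (@eq_jac _ _ _ _ u v w _ x)//; last by rewrite addrK.
  by rewrite jx /jac !mulr0 !addr0.
by move=> ->.
Qed.

(* Extend [B] to a bi-infinite matrix. Kernel vectors are determined by their first
   entry, and the range has codimension at most 1. *)
Lemma fredholm_plus B lam : U !=set0 -> V !=set0 -> W !=set0 ->
  jac_injective U (shifted_set V lam) W -> M_plus U V W B ->
  fredholm_on p (shifted_op B lam).
Proof.
move=> [u0 U0] [v0 V0] [w0 W0] inj BM.
pose un n := if n is m.+1 then B m.+1 m else u0.
pose u := extend_diag u0 un.
pose v := extend_diag (v0 - lam) (fun n => B n n - lam).
pose w := extend_diag w0 (fun n => B n n.+1).
have inM : jac_in U (shifted_set V lam) W u v w.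
  case=> [n|n]; rewrite /u /v /w /=; split => //.
  - case: n => [|m] //=; have [h _ _ _] := BM m.+1 m; apply: h; lia.
  - by exists (B n n) => //; have [_ h _ _] := BM n n; apply: h.
  - by have [_ _ h _] := BM n n.+1; apply: h; lia.
  - by exists v0.
have TE x (n : nat) : shifted_op B lam x n = jac u v w (extend_by0 x) n%:Z.
  rewrite (@shifted_op_plus _ _ _ B lam x n un BM)//.
  by rewrite /jac; congr (_ + _); rewrite (_ : n%:Z + 1 = n.+1%:Z)//; lia.
have [S [SX _ ST TS]] := jac_invertible p1 cU (compact_shifted cV) cW inj inM.
split.
(* Extending by zero could only fail the equation in row -1, which sees [x 0] alone; if that is 0,
   injectivity applies. *)
- have ker0 x : lp p x -> shifted_op B lam x = 0 -> x 0%N = 0 -> x = 0.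
    move=> /lp_fin[K _ xK] Tx x0; apply/funext => n.
    have := @inj u v w (extend_by0 x) K inM.
    move=> /(_ _ _ n%:Z); apply.
      exact: (bounded_by_lp p1 discrete_int (lp_le_extend_by0 xK)).
    case=> [k|[|k]]; first by rewrite -TE Tx.
      by rewrite /jac /= x0 !mulr0 !addr0.
    rewrite /jac (_ : Negz k.+1 + 1 = Negz k); last by lia.
    by rewrite (_ : Negz k.+1 - 1 = Negz k.+2) /= ?mulr0 ?addr0//; lia.
  have TM (a : C) x y : shifted_op B lam x = 0 -> shifted_op B lam y = 0 ->
      shifted_op B lam (fun n => x n - a * y n) = 0.
    move=> Tx Ty; apply/funext => n; rewrite TE.
    rewrite (@eq_jac _ _ _ _ u v w _ (fun k => extend_by0 x k - a * extend_by0 y k))//;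
      try by case: (X in extend_by0 _ X) => //= *; rewrite mulr0 subr0.
    by rewrite jacB jacZ -!TE Tx Ty mulr0 subr0.
  have [[x1 [[x1p /= Tx1] x10]]|no] := pselect (exists x,
    (lp p `&` [set x | shifted_op B lam x = 0]) x /\ x 0%N != 0).
    exists 1%N, (fun=> x1); split => // x [xp /= Tx].
    exists (fun=> x 0%N / x1 0%N); rewrite big_ord1.
    apply/funext => n; apply/eqP; rewrite -subr_eq0; apply/eqP.
    have := ker0 (fun n => x n - x 0%N / x1 0%N * x1 n).
    move=> /(_ _ (TM _ _ _ Tx Tx1)) h.
    have : (fun n => x n - x 0%N / x1 0%N * x1 n) = 0.
      apply: h; last by rewrite divfK// subrr.
      have [K _ xK] := lp_fin xp; have [K' _ x1K] := lp_fin x1p.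
      apply/lp_leP; exists (K + modulus (x 0%N / x1 0%N) * K').
      apply: (lp_leD p1 discrete_nat xK).
      have x1K' := lp_leZ p1 discrete_nat (x 0%N / x1 0%N) x1K.
      by apply: (lp_le_mono p1 discrete_nat _ x1K') => i; rewrite modulusN.
    by move=> /(congr1 (fun f => f n)).
  exists 0%N, (fun=> 0); split => [[]//|x [xp /= Tx]].
  exists (fun=> 0); rewrite big_ord0; apply: ker0 => //.
  by apply/eqP; apply/negPn/negP => x0; apply: no; exists x.
- pose e0 (n : nat) : C := if n == 0%N then 1 else 0.
  exists 1%N, (fun=> e0); split => [_|y yp].
    apply/lp_leP; exists 1; apply: (lp_le_single p1 discrete_nat (i := 0%N)).
      by rewrite modulus1.
    by move=> j /negPf j0; rewrite /e0 j0.
  have yp' := lp_extend_by0 yp.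
  pose x := S (extend_by0 y).
  have Tx : jac u v w x = extend_by0 y by exact: TS.
  exists (shifted_op B lam (fun n => x n%:Z)).
    by exists (fun n => x n%:Z) => //; apply: lp_restrict_nat (SX _ yp') => i j [].
  (* Restricting the bi-infinite solution changes only row 0, by the lost term [u 0 * x (-1)]. *)
  exists (fun=> u 0 * x (-1)); rewrite big_ord1; apply/funext => n.
  rewrite fctE TE (_ : y n = extend_by0 y n%:Z)// -Tx /jac.
  have -> : ((u 0 * x (-1)) *: e0) n = u 0 * x (-1) * e0 n by [].
  have -> : n%:Z + 1 = n.+1%:Z by lia.
  case: n => [|m] /=; first by rewrite /e0 /=; ring.
  by rewrite /e0 /= mulr0 addr0 subn1 (_ : m.+1%:Z - 1 = m%:Z)//; lia.
Qed.

End SemiInfinite.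

Lemma PsiE_plus_M_plus (R : realType) (U V W : set (Cplx R)) Ap :
  PsiE_plus U V W Ap -> M_plus U V W Ap.
Proof.
move=> [A [AM _] <-] i j; have [h1 h2 h3 h4] := AM i.+1%:Z j.+1%:Z.
by split => /= h; [apply: h1|apply: h2|apply: h3|apply: h4] => /=; lia.
Qed.

(** * Pseudoergodic operators are not Fredholm; invertibility on the half-line *)

Section NotFredholmPsi.
Variables (R : realType).
Local Notation C := (Cplx R).
Variables (p : \bar R) (p1 : (1 <= p)%E).
Variables U V W : set C.
Hypotheses (cU : compact U) (cV : compact V) (cW : compact W).

Lemma not_fredholm_PsiE A lam : PsiE U V W A ->
  ~ jac_injective U (shifted_set V lam) W -> ~ fredholm_on p (shifted_op A lam).
Proof.
move=> AP ninj; have AM := AP.1.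
apply: (@weyl_not_fredholm R p p1 _ int discrete_int _
  (fun i => [:: (i - 1, subdiag A i); (i, maindiag A i - lam); (i + 1, superdiag A i)])).
  move=> x i; rewrite (shifted_op_jac lam AM) !big_cons big_nil addr0.
  by rewrite /jac addrA.
move=> e s e0; rewrite (shifted_op_jac lam AM).
have [y [t [yt ybig yT]]] := psi_approx_kernel cU cV cW p1 AP ninj s e0.
by exists y, t; split => // i /yt[].
Qed.

Lemma not_fredholm_PsiE_plus Ap lam : PsiE_plus U V W Ap ->
  ~ jac_injective U (shifted_set V lam) W -> ~ fredholm_on p (shifted_op Ap lam).
Proof.
move=> ApP ninj; have ApM := PsiE_plus_M_plus ApP; have [A AP ApE] := ApP.
pose un n := if n is m.+1 then Ap m.+1 m else 0.
have TE x n : shifted_op Ap lam x n =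
    un n * extend_by0 x (n%:Z - 1) + (Ap n n - lam) * x n + Ap n n.+1 * x n.+1.
  exact: (shifted_op_plus _ _ _ ApM).
apply: (@weyl_not_fredholm R p p1 _ nat discrete_nat _
  (fun n => [:: (n.-1, un n); (n, Ap n n - lam); (n.+1, Ap n n.+1)])).
  move=> x i; rewrite TE !big_cons big_nil addr0 addrA; congr (_ + _ + _).
  case: i => [|m] /=; first by rewrite !mul0r.
  by rewrite subn1.
move=> e s e0.
(* Row n of the semi-infinite matrix is row n + 1 of [A], so the excluded places are shifted; the
   support is in the positive integers, so nothing is lost at the cut. *)
have [y [t [yt ybig yT]]] :=
  psi_approx_kernel cU cV cW p1 AP ninj [seq n.+1%:Z | n <- s] e0.
exists (fun n => y n.+1%:Z), [seq (absz i).-1 | i <- t]; split.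
- move=> n /yt[_ nt ns]; split; first by apply/mapP; exists n.+1%:Z.
  by apply: contraNN ns => ns; apply/mapP; exists n.
- move=> h; apply: ybig.
  apply: (@lp_le_dominated R p p1 _ int _ nat (fun k => (absz k).-1) _ _ _
    discrete_int discrete_nat _ _ h).
    move=> i j; rewrite !inE => /yt[/= Ji _ _] /yt[/= Jj _ _]; lia.
  move=> i; have [->|/yt[/= Ji _ _]] := eqVneq (y i) 0.
    by rewrite modulus0 modulus_ge0.
  by rewrite (_ : (absz i).-1.+1%:Z = i)//; lia.
- have h : injective (fun n : nat => n.+1%:Z) by move=> i j [].
  apply: (lp_le_mono p1 discrete_nat _ (lp_le_restrict_nat p1 h yT)).
  move=> n; rewrite TE /jac le_eqVlt; apply/orP; left; apply/eqP; congr modulus.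
  congr (_ + _ + _).
  - rewrite (_ : n.+1%:Z - 1 = n%:Z); last by lia.
    case: n => [|m] /=.
      rewrite mul0r; have [->|/yt[/= ]] := eqVneq (y 0) 0; first by rewrite mulr0.
      by [].
    rewrite subn1 /= -ApE /subdiag. congr (A _ _ * _); lia.
  - by rewrite -ApE.
  - by rewrite -ApE /superdiag (_ : n.+1%:Z + 1 = n.+2%:Z)//; lia.
Qed.

(* [B] is a direct summand of a bi-infinite matrix with zero coupling entries. *)
Lemma invertible_plus B lam :
  jac_injective (U `|` [set 0]) (shifted_set V lam) (W `|` [set 0]) ->
  V !=set0 -> M_plus U V W B -> invertible_on p (shifted_op B lam).
Proof.
move=> inj [v0 V0] BM.
have cU0 : compact (U `|` [set 0 : C]) by apply: compactU => //; exact: compact_set1.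
have cW0 : compact (W `|` [set 0 : C]) by apply: compactU => //; exact: compact_set1.
pose un n := if n is m.+1 then B m.+1 m else 0.
pose u := extend_diag 0 un.
pose v := extend_diag (v0 - lam) (fun n => B n n - lam).
pose w := extend_diag 0 (fun n => B n n.+1).
have inM : jac_in (U `|` [set 0]) (shifted_set V lam) (W `|` [set 0]) u v w.
  case=> [n|n]; rewrite /u /v /w /=; split => //=; try by right.
  - case: n => [|m] /=; [by right|left].
    by have [h _ _ _] := BM m.+1 m; apply: h; lia.
  - by exists (B n n) => //; have [_ h _ _] := BM n n; apply: h.
  - by left; have [_ _ h _] := BM n n.+1; apply: h; lia.
  - by exists v0.
have TE x (n : nat) : shifted_op B lam x n = jac u v w (extend_by0 x) n%:Z.
  rewrite (@shifted_op_plus _ _ _ _ B lam x n un BM)//.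
  by rewrite /jac; congr (_ + _); rewrite (_ : n%:Z + 1 = n.+1%:Z)//; lia.
have [S [SX [K SK] ST TS]] := jac_invertible p1 cU0 (compact_shifted cV) cW0 inj inM.
have inj_pos : injective Posz by move=> i j [].
exists (fun y n => S (extend_by0 y) n%:Z); split.
- by move=> x /lp_extend_by0 xp; apply: lp_restrict_nat (SX _ (xp p1)).
(* [K] may be negative, and a monotone bound is needed to pass from the norm of the extension to
   that of [x]. *)
- exists `|K| => x xp; have [k xE xk] := lp_fin xp; rewrite xE -EFinM.
  have xk' := lp_le_extend_by0 p1 xk.
  have xp' := lp_extend_by0 p1 xp.
  have [k' xE' xk''] := lp_fin xp'.
  apply: (lp_le_restrict_nat p1 inj_pos); rewrite /lp_le (le_trans (SK _ xp'))//.
  rewrite xE' -EFinM lee_fin.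
  have k'0 := lp_le_ge0 xk''.
  have kk' : k' <= k by rewrite -lee_fin -xE'.
  by apply: (le_trans (ler_norm _)); rewrite normrM (ger0_norm k'0) ler_wpM2l.
- move=> x xp; apply/funext => n.
  (* The zero coupling entries keep the image of the extension away from the negative places. *)
  have -> : extend_by0 (shifted_op B lam x) = jac u v w (extend_by0 x).
    apply/funext; case=> [m|m]; first by rewrite /= TE.
    rewrite /jac /= mul0r mul0r.
    by rewrite /extend_by0 /=; case: m => [|m] /=; rewrite ?mulr0 ?add0r ?addr0.
  by rewrite ST//; exact: lp_extend_by0.
- move=> y yp; apply/funext => n.
  have yp' := lp_extend_by0 p1 yp.
  rewrite TE -[RHS]/(extend_by0 y n%:Z) -[in RHS](TS _ yp').
  rewrite /jac (_ : n%:Z + 1 = n.+1%:Z) /=; last by lia.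
  case: n => [|m]; first by rewrite /u /= !mul0r.
  by rewrite (_ : m.+1%:Z - 1 = m%:Z)//; lia.
Qed.

End NotFredholmPsi.

(** * Enclosures and ellipses *)

Section Bounds.
Variables (R : realType).
Local Notation C := (Cplx R).
Implicit Types (A U V W : set C).

(** Turns a pointwise strict inequality into a uniform gap, which the contraction argument
    requires. *)
Lemma compact_gap_above A (c : R) : compact A -> (forall z, A z -> c < modulus z) ->
  exists2 e, c < e & forall z, A z -> e <= modulus z.
Proof.
move=> cA Ac; apply: contrapT => no.
have /choice[a aP] : forall n : nat, exists z : C, A z /\ modulus z < c + n.+1%:R^-1.
  move=> n; apply: contrapT => non; apply: no.
  exists (c + n.+1%:R^-1) => [|z Az]; first by rewrite ltrDl invr_gt0.
  by rewrite leNgt; apply/negP => h; apply: non; exists z.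
have [F [UF sF]] := ultraFilterLemma eventually_filter.
have [l Al al] := ulim_compact cA (fun n => (aP n).1).
have := Ac l Al; rewrite ltNge => /negP; apply; apply/ler_addgt0Pr => e e0.
apply: (ulim_modulus_le _ al); apply: sF; near=> n => /=.
rewrite (le_trans (ltW (aP n).2))// lerD2l ltW//.
near: n; exact: near_infty_natSinv_lt (PosNum e0).
Unshelve. all: by end_near. Qed.

Lemma compact_gap_below A (c : R) : compact A -> A !=set0 ->
  (forall z, A z -> modulus z < c) ->
  exists2 e, 0 <= e < c & forall z, A z -> modulus z <= e.
Proof.
move=> cA [z0 Az0] Ac; apply: contrapT => no.
have /choice[a aP] : forall n : nat, exists z : C, A z /\ c - n.+1%:R^-1 < modulus z.
  move=> n; apply: contrapT => non; apply: no.
  exists (Num.max (modulus z0) (c - n.+1%:R^-1)) => [|z Az].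
    by rewrite le_max modulus_ge0/= gt_max Ac//= ltrBlDr ltrDl invr_gt0.
  rewrite le_max; apply/orP; right.
  by rewrite leNgt; apply/negP => h; apply: non; exists z.
have [F [UF sF]] := ultraFilterLemma eventually_filter.
have [l Al /cvg_modulusP al] := ulim_compact cA (fun n => (aP n).1).
have d0 : 0 < (c - modulus l) / 2 by rewrite divr_gt0// subr_gt0 Ac.
have h2 : F [set n : nat | n.+1%:R^-1 < (c - modulus l) / 2].
  by apply: sF; exact: near_infty_natSinv_lt (PosNum d0).
have [n [/= h3 h4]] := @filter_ex _ _ _ _ (filterI (al _ d0) h2).
have h5 := (aP n).2.
have : modulus (a n) <= modulus (a n - l) + modulus l.
  by rewrite -[X in modulus X <= _](subrK l) modulusD.
by rewrite modulus_distrC => h6; move: h3 h4 h5 h6; clear; move: (n.+1%:R^-1) => i; lra.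
Qed.

Lemma modulus_le_max U z : compact U -> U z -> modulus z <= max_modulus U.
Proof.
move=> cU Uz; have [K _ UK] := compact_modulus_le cU.
apply: ub_le_sup; last by exists z.
by exists K => _ [y Uy <-]; exact: UK.
Qed.

Lemma min_modulus_le U z : U z -> min_modulus U <= modulus z.
Proof.
move=> Uz; apply: ge_inf; last by exists z.
by exists 0 => _ [y Uy <-]; exact: modulus_ge0.
Qed.

Lemma max_modulus_ge0 U : compact U -> U !=set0 -> 0 <= max_modulus U.
Proof.
by move=> cU [z Uz]; rewrite (le_trans (modulus_ge0 z))// modulus_le_max.
Qed.

Lemma bounded_contraction_eq0 (x : int -> C) (K q : R) : 0 <= q -> q < 1 ->
  bounded_by x K -> (forall L, 0 <= L -> bounded_by x L -> bounded_by x (q * L)) ->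
  forall k, x k = 0.
Proof.
move=> q0 q1 xK h k.
have K0 : 0 <= K := le_trans (modulus_ge0 _) (xK 0).
have xqm m : bounded_by x (q ^+ m * K).
  elim: m => [|m IH]; first by rewrite expr0 mul1r.
  by rewrite exprS -mulrA; apply: h => //; rewrite mulr_ge0 ?exprn_ge0.
apply/eqP; rewrite -modulus_eq0 eq_le modulus_ge0 andbT.
have lim : (fun m => q ^+ m * K) @ \oo --> (0 : R).
  rewrite -[X in _ --> X](mul0r K); apply: cvgMl.
  by apply: cvg_expr; rewrite ger0_norm.
apply: (cvgr_to_ge lim).
by near do exact: xqm.
Unshelve. all: by end_near. Qed.

(** Diagonal dominance: solving row k for x_k shrinks any bound on [x] by the factor (a + b)/e. *)
Lemma jac_injective_diagonal U V W (a b e : R) :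
  0 <= a -> 0 <= b -> a + b < e ->
  (forall z, U z -> modulus z <= a) -> (forall z, W z -> modulus z <= b) ->
  (forall z, V z -> e <= modulus z) -> jac_injective U V W.
Proof.
move=> a0 b0 abe Ua Wb Ve u v w x K inM xK jx.
have e0 : 0 < e by lra.
apply: (@bounded_contraction_eq0 x K ((a + b) / e)) => //.
- by rewrite divr_ge0 ?addr_ge0// ltW.
- by rewrite ltr_pdivrMr// mul1r.
move=> L L0 xL k; have [/Ua h1 /Ve h2 /Wb h3] := inM k.
rewrite mulrAC ler_pdivlMr//.
have : v k * x k = - (u k * x (k - 1) + w k * x (k + 1)).
  by have := jx k; rewrite /jac => /eqP; rewrite addrAC addr_eq0 => /eqP ->; rewrite opprK.
move=> /(congr1 (@modulus R)); rewrite modulusN modulusM => h4.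
apply: (@le_trans _ _ (modulus (v k) * modulus (x k))).
  by rewrite mulrC ler_wpM2r ?modulus_ge0.
rewrite h4 mulrDl; apply: (le_trans (modulusD _ _)); apply: lerD; rewrite modulusM.
  by apply: ler_pM; rewrite ?modulus_ge0//; exact: xL.
by apply: ler_pM; rewrite ?modulus_ge0//; exact: xL.
Qed.

(** Here the subdiagonal dominates, so row k + 1 is the one to solve for x_k. *)
Lemma jac_injective_subdiagonal U V W (a b e : R) : 0 <= b -> 0 <= e ->
  e + b < a ->
  (forall z, U z -> a <= modulus z) -> (forall z, W z -> modulus z <= b) ->
  (forall z, V z -> modulus z <= e) -> jac_injective U V W.
Proof.
move=> b0 e0 eba Ua Wb Ve u v w x K inM xK jx.
have a0 : 0 < a by lra.
apply: (@bounded_contraction_eq0 x K ((e + b) / a)) => //.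
- by rewrite divr_ge0 ?addr_ge0// ltW.
- by rewrite ltr_pdivrMr// mul1r.
move=> L L0 xL k; have [/Ua h1 /Ve h2 /Wb h3] := inM (k + 1).
rewrite mulrAC ler_pdivlMr//.
have : u (k + 1) * x k = - (v (k + 1) * x (k + 1) + w (k + 1) * x (k + 1 + 1)).
  by have := jx (k + 1); rewrite /jac addrK -addrA => /eqP; rewrite addr_eq0 => /eqP ->.
move=> /(congr1 (@modulus R)); rewrite modulusN modulusM => h4.
apply: (@le_trans _ _ (modulus (u (k + 1)) * modulus (x k))).
  by rewrite mulrC ler_wpM2r ?modulus_ge0.
rewrite h4 mulrDl; apply: (le_trans (modulusD _ _)); apply: lerD; rewrite modulusM.
  by apply: ler_pM; rewrite ?modulus_ge0//; exact: xL.
by apply: ler_pM; rewrite ?modulus_ge0//; exact: xL.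
Qed.

(** Reversing the order of the integers exchanges the two off-diagonals. *)
Lemma jac_injective_reflect U V W : jac_injective W V U -> jac_injective U V W.
Proof.
move=> inj u v w x K inM xK jx k.
rewrite -[k]opprK.
apply: (inj (fun k => w (- k)) (fun k => v (- k)) (fun k => u (- k)) (fun k => x (- k)) K).
- by move=> j; have [] := inM (- j).
- by move=> j; exact: xK.
move=> j; rewrite -[RHS](jx (- j)) /jac opprD opprK (opprD j 1).
by rewrite addrC [in RHS]addrAC addrA; ring.
Qed.

Lemma unit_disc_closure (z : C) : modulus z <= 1 -> closure (@unit_disc R) z.
Proof.
move=> z1 B /nbhs_ballP[e /= e0 eB].
have e'0 : 0 < modulus e by rewrite -ltr_toC -gt0_toC// toC0.
pose t : R := Num.min 1 (modulus e / 2).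
have t0 : 0 < t by rewrite lt_min ltr01 divr_gt0.
have t1 : t <= 1 by rewrite ge_min lexx.
have te : t < modulus e.
  by rewrite (@le_lt_trans _ _ (modulus e / 2))// ?ge_min ?lexx ?orbT//; lra.
exists (toC (1 - t) * z); split.
  rewrite /unit_disc /= -toC_modulus -toC1 ltr_toC modulusM modulus_toC ger0_norm; last lra.
  have := modulus_ge0 z; nra.
apply: eB; rewrite -ball_normE /= -toC_modulus (gt0_toC e0) ltr_toC.
have -> : z - toC (1 - t) * z = toC t * z.
  by rewrite (_ : toC (1 - t) = 1 - toC t :> C); [ring|rewrite /toC rmorphB].
rewrite modulusM modulus_toC ger0_norm; last lra.
have := modulus_ge0 z; nra.
Qed.

Lemma upper_disc V (v lam : C) (r : R) : V v -> 0 <= r -> modulus (v - lam) <= r ->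
  sumset V (dilate (toC r) (closure (@unit_disc R))) lam.
Proof.
move=> Vv r0 vr; exists v => //; exists (lam - v); last by rewrite addrC subrK.
have [r_eq|rn] := eqVneq r 0.
  exists 0; first by apply: unit_disc_closure; rewrite modulus0.
  apply/esym/eqP; rewrite mulr0 -modulus_eq0 eq_le modulus_ge0 andbT.
  by rewrite modulus_distrC (le_trans vr)// r_eq.
have rp : 0 < r by rewrite lt_def rn r0.
have toCn0 : toC r != 0 :> C by rewrite -modulus_eq0 modulus_toC normr_eq0.
exists ((lam - v) / toC r); last by rewrite mulrC divfK.
apply: unit_disc_closure; rewrite modulusM modulusV modulus_toC ger0_norm//.
by rewrite ler_pdivrMr// mul1r modulus_distrC.
Qed.

Lemma parallelogram_law (P Q : C) :
  `|P + Q| ^+ 2 + `|P - Q| ^+ 2 = 2 * (`|P| ^+ 2 + `|Q| ^+ 2).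
Proof. by rewrite !normCK !rmorphD !rmorphN/=; ring. Qed.

(* With [A^2 = u], [B^2 = w], [t^2 = z] one has [e +- 2AB = (At +- B/t)^2], and the
   parallelogram law turns the equation of the ellipse into
   [|u||z| + |w|/|z| = |u| + |w|]. *)
Lemma ellipse_root (u w e z : C) : u != 0 -> z != 0 -> ellipse u w e ->
  e * z = u * z ^+ 2 + w -> `|u| * `|z| ^+ 2 + `|w| = (`|u| + `|w|) * `|z|.
Proof.
move=> u0 z0 Ee ez.
pose A := sqrtC u; pose B := sqrtC w; pose t := sqrtC z.
have AA : A ^+ 2 = u by exact: sqrtCK.
have BB : B ^+ 2 = w by exact: sqrtCK.
have tt : t ^+ 2 = z by exact: sqrtCK.
have t0 : t != 0 by rewrite sqrtC_eq0.
have eE : e = (A * t) ^+ 2 + (B / t) ^+ 2.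
  apply: (mulIf z0); rewrite ez -AA -BB -tt; field; exact: t0.
have ABE : (A * t) * (B / t) = A * B by field; exact: t0.
have sum : `|e + 2 * (A * B)| + `|e - 2 * (A * B)| = 2 * (`|u| + `|w|).
  (* The chosen square roots multiply only up to sign, and the ellipse is symmetric under that
     sign. *)
  have [s|s] : sqrtC (u * w) = A * B \/ sqrtC (u * w) = - (A * B).
    have : sqrtC (u * w) ^+ 2 == (A * B) ^+ 2 by rewrite sqrtCK exprMn AA BB.
    by rewrite eqf_sqr => /orP[] /eqP; [left|right].
  - by rewrite -s; exact: Ee.
  - by have := Ee; rewrite /ellipse /= s !mulrN opprK addrC.
have e1 : e + 2 * (A * B) = (A * t + B / t) ^+ 2 by rewrite eE -ABE; ring.
have e2 : e - 2 * (A * B) = (A * t - B / t) ^+ 2 by rewrite eE -ABE; ring.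
move: sum; rewrite e1 e2 !normrX parallelogram_law => /(mulfI _) h.
have {h} : `|A * t| ^+ 2 + `|B / t| ^+ 2 = `|u| + `|w| by apply: h; rewrite pnatr_eq0.
rewrite -!normrX !exprMn exprVn AA BB tt !normrM normfV => h.
have nz0 : `|z| != 0 by rewrite normr_eq0.
rewrite -h; field; exact: nz0.
Qed.

(** The ellipse consists of values u z + w/z on the unit circle. A root of u z^2 - e z + w has
    modulus 1 or |w|/|u|; in the second case the other root w/(u z) has modulus 1. If u or w is 0,
    the ellipse is a circle. *)
Lemma ellipse_param (u w e : C) : ellipse u w e ->
  exists2 z : C, modulus z = 1 & e * z = u * z ^+ 2 + w.
Proof.
move=> Ee.
suff [z z1 ez] : exists2 z : C, `|z| = 1 & e * z = u * z ^+ 2 + w.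
  by exists z => //; apply: toC_inj; rewrite toC_modulus.
have degenerate : u * w = 0 -> `|e| = `|u| + `|w|.
  move=> uw; have := Ee; rewrite /ellipse /= uw sqrtC0 mulr0 addr0 subr0.
  move=> h; apply: (mulfI (_ : (2 : C) != 0)); first by rewrite pnatr_eq0.
  by rewrite -h mulr_natl mulr2n.
have [u0|u0] := eqVneq u 0.
  rewrite u0 in degenerate *; rewrite normr0 mul0r add0r in degenerate.
  have {degenerate} ew := degenerate erefl.
  have [w0|w0] := eqVneq w 0.
    exists 1; rewrite ?normr1// w0 mul0r add0r.
    by move: ew; rewrite w0 normr0 => /normr0_eq0 ->; rewrite mul0r.
  have e0 : e != 0 by rewrite -normr_eq0 ew normr_eq0.
  exists (w / e); first by rewrite normrM normfV ew divff ?normr_eq0.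
  by rewrite mul0r add0r mulrC divfK.
have [w0|w0] := eqVneq w 0.
  have := degenerate; rewrite w0 mulr0 normr0 addr0 => /(_ erefl) eu.
  exists (e / u); first by rewrite normrM normfV eu divff ?normr_eq0.
  by rewrite addr0; field.
pose z := (e + sqrtC (e ^+ 2 - 4 * u * w)) / (2 * u).
have ez : e * z = u * z ^+ 2 + w.
  have := sqrtCK (e ^+ 2 - 4 * u * w); rewrite /z.
  move: (sqrtC _) => d dE.
  apply/eqP; rewrite -subr_eq0; apply/eqP.
  have -> : e * ((e + d) / (2 * u)) - (u * ((e + d) / (2 * u)) ^+ 2 + w) =
     (e ^+ 2 - 4 * u * w - d ^+ 2) / (4 * u) by field.
  by rewrite dE subrr mul0r.
have z0 : z != 0.
  apply: contra_neq w0 => z0; move: ez.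
  by rewrite z0 expr2 !mulr0 add0r.
have := ellipse_root u0 z0 Ee ez => h.
have nu : `|u| != 0 by rewrite normr_eq0.
have nz : `|z| != 0 by rewrite normr_eq0.
have : (`|z| - 1) * (`|u| * `|z| - `|w|) = 0.
  have -> : (`|z| - 1) * (`|u| * `|z| - `|w|) =
    `|u| * `|z| ^+ 2 + `|w| - (`|u| + `|w|) * `|z| by ring.
  by rewrite h subrr.
move=> /eqP; rewrite mulf_eq0 !subr_eq0 => /orP[/eqP z1|/eqP z1].
  by exists z.
exists (w / (u * z)).
  by rewrite normrM normfV normrM z1 divff// normr_eq0.
apply: (mulIf (expf_neq0 2 z0)); apply: (mulIf u0).
have -> : e * (w / (u * z)) * z ^+ 2 * u = w * (e * z) by field; apply/andP; split.
by rewrite ez; field; apply/andP; split.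
Qed.

(** Constant diagonals suffice: with |z| = 1 the bounded sequence z^-k is in the kernel, its symbol
    u z + w/z being the point of the ellipse. *)
Lemma ellipses_not_injective U V W lam :
  sumset V (ellipses U W) lam -> ~ jac_injective U (shifted_set V lam) W.
Proof.
move=> [v Vv [e [u Uu [w Ww Ee]] <-]] inj.
have [z z1 ez] := ellipse_param Ee.
have z0 : z != 0 by rewrite -modulus_eq0 z1 oner_eq0.
have : (fun k : int => z ^ (- k)) 0 = 0.
  apply: (inj (fun=> u) (fun=> v - (v + e)) (fun=> w) (fun k : int => z ^ (- k)) 1).
  - by move=> k; split => //; exists v.
  - move=> k; have h n : modulus (z ^+ n) = 1.
      by elim: n => [|n IH]; rewrite ?modulus1// exprS modulusM z1 IH mul1r.
    case: (- k) => n /=; first by rewrite -exprnP h.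
    by rewrite /exprz modulusV h invr1.
  move=> k; rewrite /jac opprB (opprD k) !expfzDr// expr1z.
  have -> : z ^ (-1) = z^-1 by [].
  have -> : v - (v + e) = - e by ring.
  apply: (mulIf z0); rewrite mul0r.
  transitivity ((u * z ^+ 2 + w - e * z) * z ^ (- k)); first by field.
  by rewrite ez subrr mul0r.
by rewrite oppr0 expr0z => /eqP; rewrite oner_eq0.
Qed.

End Bounds.

(** * Spectral enclosures for bi-infinite, semi-infinite and finite matrices *)

Section Enclosures.
Variables (R : realType).
Local Notation C := (Cplx R).
Variables U V W : set C.
Hypotheses (U0 : U !=set0) (V0 : V !=set0) (W0 : W !=set0).
Hypotheses (cU : compact U) (cV : compact V) (cW : compact W).
Local Notation upper := (sumset V (dilate (toC (max_modulus U + max_modulus W))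
                                     (closure (@unit_disc R)))).

Lemma not_upper_gap lam : ~ upper lam ->
  exists2 e, max_modulus U + max_modulus W < e &
    forall z, shifted_set V lam z -> e <= modulus z.
Proof.
move=> nup; apply: compact_gap_above; first exact: compact_shifted.
move=> _ [v Vv <-]; rewrite ltNge; apply/negP => h; apply: nup.
by apply: (upper_disc Vv _ h); rewrite addr_ge0 ?max_modulus_ge0.
Qed.

(** Adjoining 0 respects the bounds by the two maxima, so diagonal dominance also covers the
    decoupled extension of a semi-infinite matrix. *)
Lemma jac_injective_upper lam : ~ upper lam ->
  jac_injective (U `|` [set 0]) (shifted_set V lam) (W `|` [set 0]).
Proof.
move=> /not_upper_gap[e he Ve].
have hU := max_modulus_ge0 cU U0; have hW := max_modulus_ge0 cW W0.
apply: (jac_injective_diagonal hU hW he) => // z [|->]; rewrite ?modulus0//.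
  exact: modulus_le_max.
exact: modulus_le_max.
Qed.

Lemma spec_bi_upper p A : (1 <= p)%E -> M_bi U V W A -> spec p A `<=` upper.
Proof.
move=> p1 AM lam specA; apply: contrapT => /jac_injective_upper inj; apply: specA.
apply: (invertible_bi p1 cU cV cW _ AM) => u v w x K inM.
by apply: inj => k; have [? ? ?] := inM k; split => //; left.
Qed.

Lemma spec_plus_upper p A : (1 <= p)%E -> M_plus U V W A -> spec p A `<=` upper.
Proof.
move=> p1 AM lam specA; apply: contrapT => /jac_injective_upper inj; apply: specA.
exact: (invertible_plus p1 cU cV cW inj V0 AM).
Qed.

Lemma sum_indicator_le n (c : R) (m : nat) : 0 <= c ->
  \sum_(i < n) c * (val i == m)%:R <= c.
Proof.
move=> c0; have [mn|nm] := ltnP m n.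
  rewrite (bigD1 (Ordinal mn))//= eqxx mulr1 big1 ?addr0// => i im.
  by rewrite (_ : (val i == m) = false) ?mulr0//; apply: negbTE; exact: im.
rewrite big1// => i _; rewrite (_ : (val i == m) = false) ?mulr0//.
by apply/negbTE; rewrite neq_ltn (leq_trans (ltn_ord i)).
Qed.

(** Gershgorin's argument by columns: a left kernel vector is examined at its entry of largest
    modulus, where the column has at most one entry from U and one from W off the diagonal. *)
Lemma spec_fin_upper n (A : 'M[C]_n) : (0 < n)%N -> M_n U V W A ->
  spec_mx A `<=` upper.
Proof.
case: n A => // n A _ AM lam nunit.
have [z z0 zA] : exists2 z : 'rV[C]_n.+1, z != 0 & z *m (A - lam%:M) = 0.
  apply: contrapT => no; apply: nunit; rewrite -row_free_unit; apply: inj_row_free => z zA.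
  by apply/eqP; apply/negPn/negP => z0; apply: no; exists z.
have [j _ jmax] := @arg_maxP _ _ _ (ord0 : 'I_n.+1) xpredT (fun j => modulus (z 0 j)) isT.
have zj : 0 < modulus (z 0 j).
  rewrite lt_def modulus_ge0 andbT; apply: contra_neq z0 => zj0.
  apply/rowP => i; rewrite [RHS]mxE; apply/eqP.
  rewrite -modulus_eq0 eq_le modulus_ge0 andbT.
  by rewrite -zj0; exact: jmax.
have Vj : V (A j j) by have [_ h _ _] := AM j j; apply: h.
have hU := max_modulus_ge0 cU U0; have hW := max_modulus_ge0 cW W0.
apply: (upper_disc Vj); first by rewrite addr_ge0.
rewrite -(ler_pM2l zj) -modulusM.
have -> : z 0 j * (A j j - lam) = - \sum_(i | i != j) z 0 i * A i j.
  have /matrixP/(_ 0 j) := zA; rewrite mxE [RHS]mxE (bigD1 j)//= !mxE eqxx mulr1n.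
  rewrite (eq_bigr (fun i => z 0 i * A i j)) => [|i ij].
    by move=> /eqP; rewrite addr_eq0 => /eqP.
  by rewrite !mxE (negPf ij) mulr0n subr0.
rewrite modulusN; apply: (le_trans (modulus_sum _ _ _)).
(* For j = 0 the truncated predecessor is [j] itself, which is not in the sum on the left; the
   majorant only grows. *)
apply: (@le_trans _ _ (\sum_(i < n.+1) modulus (z 0 j) *
   (max_modulus U * (val i == j.+1)%:R + max_modulus W * (val i == j.-1)%:R))).
  rewrite [leRHS](bigID (fun i => i != j))/= -[leLHS]addr0; apply: lerD; last first.
    apply: sumr_ge0 => i _; rewrite mulr_ge0 ?modulus_ge0//.
    by rewrite addr_ge0// mulr_ge0.
  apply: ler_sum => i ij; rewrite modulusM; apply: ler_pM; rewrite ?modulus_ge0//.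
    exact: jmax.
  have [hu _ hw h0] := AM i j.
  have ij' : val i != val j by [].
  have [e1|n1] := eqVneq (val i) j.+1.
    rewrite mulr1; apply: (@le_trans _ _ (max_modulus U)).
      by apply: modulus_le_max => //; apply: hu; rewrite -[nat_of_ord i]/(val i) e1; lia.
    by rewrite lerDl mulr_ge0.
  rewrite mulr0 add0r; have [e2|n2] := eqVneq (val i) j.-1.
    rewrite mulr1; apply: modulus_le_max => //; apply: hw.
    by move: e2 ij' => /= e2 /eqP ij'; lia.
  rewrite mulr0 h0 ?modulus0//.
  by move: n1 n2 ij' => /= /eqP n1 /eqP n2 /eqP ij'; lia.
rewrite -mulr_sumr ler_wpM2l ?modulus_ge0// big_split/=.
by apply: lerD; exact: sum_indicator_le.
Qed.

Lemma shifted_gap_below lam (r : R) :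
  (\bigcap_(v in V) translate v (dilate (toC r) (@unit_disc R))) lam -> 0 < r ->
  exists2 e, 0 <= e < r & forall z, shifted_set V lam z -> modulus z <= e.
Proof.
move=> lamr r0; apply: compact_gap_below; first exact: compact_shifted.
  by have [v Vv] := V0; exists (v - lam); exists v.
move=> _ [v Vv <-]; have [_ -> [_ [z z1 <-] <-]] := lamr v Vv.
rewrite opprD addrA subrr sub0r modulusN modulusM modulus_toC gtr0_norm//.
by rewrite gtr_pMr// -ltr_toC toC_modulus.
Qed.

Lemma spec_bi_lower_sub p A : (1 <= p)%E -> M_bi U V W A ->
  max_modulus W < min_modulus U ->
  spec p A `<=` ~` \bigcap_(v in V)
     translate v (dilate (toC (min_modulus U - max_modulus W)) (@unit_disc R)).
Proof.
move=> p1 AM wu lam specA /shifted_gap_below; rewrite subr_gt0 => /(_ wu)[e /andP[e0 he] Ve].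
apply: specA; apply: (invertible_bi p1 cU cV cW _ AM).
apply: (@jac_injective_subdiagonal _ _ _ _ (min_modulus U) (max_modulus W) e) => //.
- exact: max_modulus_ge0.
- by lra.
- exact: min_modulus_le.
- by move=> z; exact: modulus_le_max.
Qed.

Lemma spec_bi_lower_super p A : (1 <= p)%E -> M_bi U V W A ->
  max_modulus U < min_modulus W ->
  spec p A `<=` ~` \bigcap_(v in V)
     translate v (dilate (toC (min_modulus W - max_modulus U)) (@unit_disc R)).
Proof.
move=> p1 AM uw lam specA /shifted_gap_below; rewrite subr_gt0 => /(_ uw)[e /andP[e0 he] Ve].
apply: specA; apply: (invertible_bi p1 cU cV cW _ AM); apply: jac_injective_reflect.
apply: (@jac_injective_subdiagonal _ _ _ _ (min_modulus W) (max_modulus U) e) => //.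
- exact: max_modulus_ge0.
- by lra.
- exact: min_modulus_le.
- by move=> z; exact: modulus_le_max.
Qed.

End Enclosures.

Theorem theorem2p1 (R : realType) (U V W : set (Cplx R))
    (U0 : U !=set0) (V0 : V !=set0) (W0 : W !=set0)
    (cU : compact U) (cV : compact V) (cW : compact W)
    (p : \bar R) (p1 : (1 <= p)%E) :
  let umax := max_modulus U in let umin := min_modulus U in
  let wmax := max_modulus W in let wmin := min_modulus W in
  let upper := sumset V (dilate (toC (umax + wmax)) (closure (@unit_disc R))) in
  (forall (A : int -> int -> Cplx R) (Ap : nat -> nat -> Cplx R),
     PsiE U V W A -> PsiE_plus U V W Ap ->
     sumset V (ellipses U W) `<=` \bigcup_(B in M_bi U V W) spec p B /\
     \bigcup_(B in M_bi U V W) spec p B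
       = \bigcup_(B in M_bi U V W) spec_pt_infty B /\
     \bigcup_(B in M_bi U V W) spec_pt_infty B
       = \bigcup_(B in M_bi U V W) spec_ess p B /\
     \bigcup_(B in M_bi U V W) spec_ess p B
       = \bigcup_(Bp in M_plus U V W) spec_ess p Bp /\
     \bigcup_(Bp in M_plus U V W) spec_ess p Bp = spec_ess p A /\
     spec_ess p A = spec p A /\
     spec p A = spec_ess p Ap /\
     spec_ess p Ap `<=` spec p Ap /\
     spec p Ap `<=` upper) /\
  (forall A : int -> int -> Cplx R, M_bi U V W A -> spec p A `<=` upper) /\
  (forall A : nat -> nat -> Cplx R, M_plus U V W A -> spec p A `<=` upper) /\
  (forall (n : nat) (A : 'M[Cplx R]_n), (0 < n)%N ->
     M_n U V W A -> spec_mx A `<=` upper) /\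
  (forall A : int -> int -> Cplx R, M_bi U V W A ->
     (wmax < umin ->
        spec p A `<=` ~` \bigcap_(v in V)
          translate v (dilate (toC (umin - wmax)) (@unit_disc R))) /\
     (umax < wmin ->
        spec p A `<=` ~` \bigcap_(v in V)
          translate v (dilate (toC (wmin - umax)) (@unit_disc R)))).
Proof.
split; last first.
  split; first by move=> A; exact: spec_bi_upper.
  split; first by move=> A; exact: spec_plus_upper.
  split; first by move=> n A n0; exact: spec_fin_upper.
  by move=> A AM; split; [exact: spec_bi_lower_sub|exact: spec_bi_lower_super].
move=> A Ap AP ApP; have AM := AP.1; have ApM := PsiE_plus_M_plus ApP.
pose inj lam := jac_injective U (shifted_set V lam) W.
have spec_ess_sub_bi B : M_bi U V W B -> spec_ess p B `<=` spec p B.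
  move=> BM lam nF; apply: contra_not nF.
  exact: (invertible_fredholm p1 discrete_int (finite_rows_bi BM)).
have spec_ess_sub_plus B : M_plus U V W B -> spec_ess p B `<=` spec p B.
  move=> BM lam nF; apply: contra_not nF.
  exact: (invertible_fredholm p1 discrete_nat (finite_rows_plus BM)).
have spec_inj B lam : M_bi U V W B -> spec p B lam -> ~ inj lam.
  by move=> BM; apply: contra_not => h; exact: (invertible_bi p1 cU cV cW h BM).
(* Pseudoergodicity acts through this inclusion and the next; [A] and [Ap] then serve as witnesses
   in the unions of spectra and essential spectra. *)
have ess_A lam : ~ inj lam -> spec_ess p A lam.
  exact: (not_fredholm_PsiE p1 cU cV cW AP).
have ess_Ap lam : ~ inj lam -> spec_ess p Ap lam.
  exact: (not_fredholm_PsiE_plus p1 cU cV cW ApP).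
have ess_plus_inj B lam : M_plus U V W B -> spec_ess p B lam -> ~ inj lam.
  by move=> BM; apply: contra_not => h; exact: (fredholm_plus p1 cU cV cW U0 V0 W0 h BM).
have setE (X : set (Cplx R)) : (forall lam, X lam -> ~ inj lam) ->
    (forall lam, ~ inj lam -> X lam) -> X = [set lam | ~ inj lam].
  by move=> h1 h2; apply/seteqP; split.
have E1 : \bigcup_(B in M_bi U V W) spec p B = [set lam | ~ inj lam].
  apply: setE => lam; first by move=> [B BM]; exact: spec_inj.
  by move=> /ess_A h; exists A => //; exact: spec_ess_sub_bi.
have E2 : \bigcup_(B in M_bi U V W) spec_pt_infty B = [set lam | ~ inj lam].
  by apply: setE => lam /spec_pt_bigcup.
have E3 : \bigcup_(B in M_bi U V W) spec_ess p B = [set lam | ~ inj lam].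
  apply: setE => lam; last by move=> /ess_A h; exists A.
  by move=> [B BM] /(spec_ess_sub_bi _ BM); exact: spec_inj.
have E4 : \bigcup_(B in M_plus U V W) spec_ess p B = [set lam | ~ inj lam].
  apply: setE => lam; last by move=> /ess_Ap h; exists Ap.
  by move=> [B BM]; exact: ess_plus_inj.
have E5 : spec_ess p A = [set lam | ~ inj lam].
  by apply: setE => // lam /(spec_ess_sub_bi _ AM); exact: spec_inj.
have E6 : spec p A = [set lam | ~ inj lam].
  apply: setE => lam; first exact: spec_inj.
  by move=> /ess_A; exact: spec_ess_sub_bi.
have E7 : spec_ess p Ap = [set lam | ~ inj lam].
  by apply: setE => // lam; exact: ess_plus_inj.
split; first by rewrite E1; exact: ellipses_not_injective.
split; first by rewrite E1 E2.
split; first by rewrite E2 E3.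
split; first by rewrite E3 E4.
split; first by rewrite E4 E5.
split; first by rewrite E5 E6.
split; first by rewrite E6 E7.
split; first exact: spec_ess_sub_plus.
exact: spec_plus_upper.
Qed.
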